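(* Let $\xi_0,\xi_1,\xi_2,\ldots$ be independent and identically distributed real random variables, and for $n\ge1$ let $\mathcal{C}_n$ be the $n\times n$ random circulant matrix whose $(i,j)$ entry, for $0\le i,j\le n-1$, is $\xi_{(j-i)\bmod n}$. Suppose $\xi_0$ satisfies condition (H): there exist $M>0$ and $q\in(0,1)$ with $\sup_{u\in\mathbb{R}}\mathbb{P}(|\xi_0-u|\le1)\le 1-q$ and $\mathbb{P}(|\xi_0|>M)\le q/2$. (1) If in addition $\xi_0$ has zero mean, finite positive variance, and a moment generating function that exists on an open interval around zero, then for any $\varepsilon>0$ and $\rho\in(0,1/4)$, for all large $n$, \[ \mathbb{P}\left(\kappa(\mathcal{C}_n)\le \frac{C_0}{\varepsilon}n^{\rho+1/2}(\log n)^{1/2}\right)\ge 1-C_1\left((\varepsilon^2+\varepsilon)n^{-2\rho}+n^{-1/2+o(1)}\right), \] where $C_0,C_1>0$ depend only on the distribution of $\xi_0$. (2) If instead $\xi_0$ has zero mean and $\mathbb{E}[\xi_0^2]<\infty$, then for any $\varepsilon>0$ and $\rho\in(0,1/4)$, for all large $n$, \[ \mathbb{P}\left(\kappa(\mathcal{C}_n)\le \frac{C_0}{\varepsilon}n^{\rho+1/2}\log n\right)\ge 1-C_2\left((\varepsilon^2+\varepsilon)n^{-2\rho}+(\log n)^{-1/2}\right), \] where $C_0,C_2>0$ depend only on the distribution of $\xi_0$.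
   Context: For a square matrix $A$, $\kappa(A)=\sigma_{\max}(A)/\sigma_{\min}(A)$ is its condition number (largest over smallest singular value; taken as $+\infty$ if $A$ is singular). The notation $n^{-1/2+o(1)}$ means $n^{-1/2+\delta_n}$ for some sequence $\delta_n\to0$. *)

(* Defs.v *)
From HB Require Import structures.
From mathcomp Require Import all_boot all_order all_algebra.
From mathcomp Require Import all_classical all_reals all_analysis.
Set Implicit Arguments. Unset Strict Implicit. Unset Printing Implicit Defensive.
Import Order.TTheory GRing.Theory Num.Theory.
Import numFieldNormedType.Exports.
Local Open Scope classical_set_scope.
Local Open Scope ring_scope.

Definition circulant (R : pzRingType) (n : nat) (x : nat -> R) : 'M[R]_n :=
  \matrix_(i < n, j < n) x ((j + n - i) %% n)%N.

(* Singular values of a real square matrix A are the square roots of the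
   eigenvalues of A^T A. *)
Definition sigma_max (R : realType) (n : nat) (A : 'M[R]_n) : R :=
  Num.sqrt (sup [set l : R | eigenvalue (A^T *m A) l]).
Definition sigma_min (R : realType) (n : nat) (A : 'M[R]_n) : R :=
  Num.sqrt (inf [set l : R | eigenvalue (A^T *m A) l]).

Definition kappa (R : realType) (n : nat) (A : 'M[R]_n) : \bar R :=
  if sigma_min A == 0 then +oo%E else (sigma_max A / sigma_min A)%:E.

(* Mutual independence + identical distribution of a sequence of real
   random variables (product rule over every finite family; taking
   B i = setT for unused indices covers arbitrary finite subfamilies). *)
Definition iid_seq (R : realType) (d : measure_display) (T : measurableType d)
  (P : probability T R) (X : nat -> {RV P >-> R}) : Prop :=
  (forall (n : nat) (B : nat -> set R), (forall i, measurable (B i)) ->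
     P (\big[setI/setT]_(i < n) (X i @^-1` B i))
     = (\prod_(i < n) P (X i @^-1` B i))%E) /\
  (forall (k : nat) (B : set R), measurable B ->
     P (X k @^-1` B) = P (X 0%N @^-1` B)).

Definition condH (R : realType) (d : measure_display) (T : measurableType d)
  (P : probability T R) (Y : {RV P >-> R}) : Prop :=
  exists (M q : R), 0 < M /\ 0 < q < 1 /\
    (forall u : R, P [set w | (`|Y w - u| <= 1)%R] <= (1 - q)%:E)%E /\
    (P [set w | (M < `|Y w|)%R] <= (q / 2)%:E)%E.

(* Main.v *)
(** Write [lam_k = sum_j xi_j exp (2 pi i j k / n)]. The squared singular values of
    the circulant matrix are the numbers [|lam_k|^2], so it suffices to bound
    [max_k |lam_k|] from above and [min_k |lam_k|] from below.

    Upper bound: Chernoff's method at [t = sqrt (ln n / n)] under the exponential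
    moment hypothesis; under a second moment, the same method at [t = 1 / sqrt n]
    for the variables truncated at [sqrt n], the discarded part being at most
    [sum_j xi_j^2 / sqrt n], which Markov's inequality controls.

    Lower bound: the indicator of [|lam_k| <= t] is dominated by a Fejer kernel on
    the grid of mesh [1 / sqrt n] with [N ~ sqrt n / t] points in each direction,
    so only finitely many values of the characteristic function of [lam_k] occur.
    Their squared modulus is at most
    [exp (- E (sum_j (1 - cos (c_j (xi_0 - xi_1)))))], where [c_j] is the value at
    the angle [2 pi j k / n] of a linear form in the cosine and the sine.
    The sum is bounded below by comparing this form with a translate of it whose
    difference has norm of order one; such a translate exists as soon as the order
    [d = n / gcd (k, n)] exceeds a multiple of [1 / t], and then the probability is
    [O(t^2 / n)]. At most [O(1 / t^2)] frequencies have a smaller order; for these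
    the bound [O(1 / n)] at scale one suffices, except for the at most two real
    eigenvalues, which contribute [O(1 / sqrt n)]. Altogether the lower bound fails
    with probability [O(t^2 + 1 / sqrt n)] when [t >= n ^ (- 1 / 4)], so that
    [delta = 0] is a valid choice in the first part. *)
Require Import Defs.
From HB Require Import structures.
From mathcomp Require Import all_boot all_order all_algebra.
From mathcomp Require Import all_classical all_reals all_analysis.
From mathcomp Require Import measurable_realfun.
From mathcomp Require Import zify ring lra.
Import Order.TTheory GRing.Theory Num.Theory.
Import numFieldNormedType.Exports.
Set Implicit Arguments. Unset Strict Implicit. Unset Printing Implicit Defensive.
Local Open Scope classical_set_scope.
Local Open Scope ring_scope.

(** * Elementary inequalities for the cosine and the exponential *)

Section elementary_inequalities.
Context {R : realType}.
Implicit Types x y : R.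

(** The mean value theorem, kept as an equality so that it yields both [|sin x| <= |x|] and, for
    small [x], a lower bound of order [|x|]. *)
Lemma sin_mean_value x : exists2 c, `|c| <= `|x| & sin x = x * cos c.
Proof.
wlog x0 : x / 0 <= x => [h|].
  have [/h //|/ltW x0] := leP 0 x.
  have [|c cx sx] := h (- x); first by rewrite oppr_ge0.
  exists c; first by rewrite -(normrN x).
  by rewrite -[x in LHS]opprK sinN sx mulNr opprK.
have [|c] := @MVT_segment R sin cos 0 x x0.
  by apply: continuous_subspaceT => y; exact: continuous_sin.
rewrite in_itv/= => /andP[c0 cx]; rewrite sin0 !subr0 => ->.
by exists c; [rewrite !ger0_norm | rewrite mulrC].
Qed.

Lemma cos_half x : cos x = 1 - 2 * sin (x / 2) ^+ 2.
Proof.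
have {1}-> : x = x / 2 *+ 2 by rewrite -mulr_natr; field.
by rewrite cos_mulr2n sin2cos2; ring.
Qed.

Lemma one_minus_cos_le x : 1 - cos x <= x ^+ 2 / 2.
Proof.
rewrite cos_half; have [c _ ->] := sin_mean_value (x / 2).
have h : cos c ^+ 2 <= 1 by rewrite cos2sin2 gerBl sqr_ge0.
have := sqr_ge0 x; rewrite exprMn; nra.
Qed.

Lemma one_minus_cos_ge x : `|x| <= 1 -> x ^+ 2 / 4 <= 1 - cos x.
Proof.
move=> x1; rewrite cos_half; have [c cx ->] := sin_mean_value (x / 2).
(* Since [|c| <= 1 / 2], the quantity [1 - cos c] is at most 1/8; then 2 (7/8)^2 / 4 = 49/128
   exceeds 1/4. *)
have h : 7 / 8 <= cos c.
  have := one_minus_cos_le c.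
  have : `|c| ^+ 2 <= 1 / 4.
    have : `|c| <= 1 / 2.
      by rewrite (le_trans cx)// normrM [`|2^-1|]ger0_norm//; lra.
    by have := normr_ge0 c; nra.
  rewrite real_normK ?num_real//; lra.
have := sqr_ge0 x; rewrite exprMn.
have : 49 / 64 <= cos c ^+ 2 by nra.
nra.
Qed.

(** For the unit complex numbers z = exp(ix) and w = exp(iy) this is |z - w|^2 <= 2 |z - 1|^2 + 2 |w
    - 1|^2, whose defect is |z + w - 2|^2. *)
Lemma one_minus_cosB x y : 1 - cos (x - y) <= 2 * (1 - cos x) + 2 * (1 - cos y).
Proof.
rewrite cosB.
have := cos2Dsin2 x; have := cos2Dsin2 y.
have := sqr_ge0 (cos x + cos y - 2); have := sqr_ge0 (sin x + sin y); nra.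
Qed.

(** For [x >= 0], e^x - 1 <= x e^x is applied twice; for [x < 0], x e^x <= x (1 + x). The linear
    term is kept exact because its expectation will vanish. *)
Lemma expR_le_quadratic x : expR x <= 1 + x + x ^+ 2 * expR `|x|.
Proof.
have h1 : expR x - 1 <= x * expR x.
  have := expR_ge1Dx (- x); rewrite expRN => h.
  have e0 := expR_gt0 x.
  have : expR x * (1 - x) <= expR x * (expR x)^-1 by rewrite ler_pM2l.
  rewrite divff ?gt_eqF//; nra.
have := expR_ge1Dx x.
have [x0|x0] := leP 0 x; first by rewrite ger0_norm//; nra.
move=> h2; have h3 := expR_ge1Dx `|x|; have := normr_ge0 x => h4.
have h5 : expR x <= 1 by rewrite -expR0 ler_expR ltW.
have := sqr_ge0 x; nra.
Qed.

(** From exp y = (exp (y / 2))^2. It serves both to absorb a quadratic factor into an exponential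
    and to turn exponential decay into a power. *)
Lemma sqr_half_le_expR y : 0 <= y -> (y / 2) ^+ 2 <= expR y.
Proof.
move=> y0; have {2}-> : y = 2 * (y / 2) by field.
rewrite expRM_natl ler_pXn2r ?nnegrE ?expR_ge0 ?divr_ge0//.
by have := expR_ge1Dx (y / 2); lra.
Qed.

End elementary_inequalities.

(** * Trigonometric sums over a full period *)

Section periodic_sums.
Context {R : realType}.

Lemma sum_shift_periodic n (F : nat -> R) i :
  (forall j, F (j + n)%N = F j) -> \sum_(j < n) F (j + i)%N = \sum_(j < n) F j.
Proof.
move=> per; elim: i => [|i <-]; first by under eq_bigr do rewrite addn0.
case: n per => [|n] per; first by rewrite !big_ord0.
rewrite big_ord_recr/= [RHS]big_ord_recl/= addrC add0n addnS -addSn addnC per.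
by congr (_ + _); apply: eq_bigr => j _; rewrite /bump/= add1n addnS addSn.
Qed.

Definition theta n k : R := pi *+ 2 * k%:R / n%:R.

Lemma theta_swap n k j : theta n k * j%:R = theta n j * k%:R.
Proof. by rewrite /theta; ring. Qed.

Lemma theta_double n k j : theta n (k.*2) * j%:R = theta n k * j%:R *+ 2.
Proof. by rewrite /theta -muln2 natrM -mulr_natr; ring. Qed.

Lemma theta_period n k : (0 < n)%N -> theta n k * n%:R = pi *+ 2 *+ k.
Proof. by move=> n0; rewrite /theta divfK ?pnatr_eq0 -?lt0n// mulr_natr. Qed.

Lemma cos_theta_period n k x : (0 < n)%N -> cos (x + theta n k * n%:R) = cos x.
Proof. by move=> n0; rewrite theta_period// (periodicn (@cosD2pi R)). Qed.

Lemma sin_theta_period n k x : (0 < n)%N -> sin (x + theta n k * n%:R) = sin x.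
Proof. by move=> n0; rewrite theta_period// (periodicn (@sinD2pi R)). Qed.

Lemma cos_thetaD n k j x : (0 < n)%N ->
  cos (theta n k * (j + n)%:R + x) = cos (theta n k * j%:R + x).
Proof. by move=> n0; rewrite natrD mulrDr addrAC cos_theta_period. Qed.

Lemma sin_thetaD n k j x : (0 < n)%N ->
  sin (theta n k * (j + n)%:R + x) = sin (theta n k * j%:R + x).
Proof. by move=> n0; rewrite natrD mulrDr addrAC sin_theta_period. Qed.

Lemma cos_theta_neq1 n k : (0 < n)%N -> ~~ (n %| k)%N -> cos (theta n k) != 1.
Proof.
move=> n0 nk.
have nR : 0 < n%:R :> R by rewrite ltr0n.
have kn := ltn_pmod k n0.
have k0 : (0 < k %% n)%N by rewrite lt0n.
have -> : cos (theta n k) = cos (theta n (k %% n)).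
  rewrite {1}(divn_eq k n) -[RHS](periodicn (@cosD2pi R) (k %/ n)); congr cos.
  rewrite /theta natrD natrM -mulr_natr; field.
  by rewrite gt_eqF.
have s0 : 0 < sin (theta n (k %% n) / 2).
  apply: sin_gt0_pi; rewrite /theta.
  have -> : pi *+ 2 * (k %% n)%:R / n%:R / 2 = pi * ((k %% n)%:R / n%:R) :> R.
    by rewrite -mulr_natr; field; rewrite gt_eqF.
  have := @pi_gt0 R => p0.
  rewrite mulr_gt0//= ?divr_gt0 ?ltr0n//.
  by rewrite gtr_pMr// ltr_pdivrMr// mul1r ltr_nat.
by rewrite cos_half lt_eqF//; have := exprn_gt0 2 s0; lra.
Qed.

(* Shifting the summation index rotates the vector of the two sums by the
   angle [theta n k], which is not a multiple of [2 * pi]. *)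
Lemma sum_cos_sin_theta0 n k : (0 < n)%N -> ~~ (n %| k)%N ->
  \sum_(j < n) cos (theta n k * j%:R) = 0 /\
  \sum_(j < n) sin (theta n k * j%:R) = 0.
Proof.
move=> n0 nk; set C := \sum_(j < n) cos _; set S := \sum_(j < n) sin _.
have hC : C = cos (theta n k) * C - sin (theta n k) * S.
  rewrite {1}/C -(@sum_shift_periodic n (fun j => cos (theta n k * j%:R)) 1).
    rewrite 2!mulr_sumr -sumrB; apply: eq_bigr => j _.
    by rewrite natrD mulrDr mulr1 cosD; ring.
  by move=> j; have := cos_thetaD k j 0 n0; rewrite !addr0.
have hS : S = sin (theta n k) * C + cos (theta n k) * S.
  rewrite {1}/S -(@sum_shift_periodic n (fun j => sin (theta n k * j%:R)) 1).
    rewrite 2!mulr_sumr -big_split/=; apply: eq_bigr => j _.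
    by rewrite natrD mulrDr mulr1 sinD; ring.
  by move=> j; have := sin_thetaD k j 0 n0; rewrite !addr0.
have c1 := cos_theta_neq1 n0 nk; have cs := cos2Dsin2 (theta n k).
have h : (1 - cos (theta n k)) * (C ^+ 2 + S ^+ 2) = 0.
  by rewrite mulrDr -[X in _ = X](subrr (C ^+ 2 + S ^+ 2)); nra.
move/eqP: h; rewrite mulf_eq0 subr_eq0 eq_sym (negbTE c1)/=.
by rewrite paddr_eq0 ?sqr_ge0// !sqrf_eq0 => /andP[/eqP-> /eqP->].
Qed.

(** Linearizing the square leaves its mean plus sums at the doubled frequency, hence the condition
    on [k.*2]. The excluded frequencies are those at which all the sines vanish. *)
Lemma sum_sqr_trig n k (a b : R) : (0 < n)%N -> ~~ (n %| k.*2)%N ->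
  \sum_(j < n) (a * cos (theta n k * j%:R) + b * sin (theta n k * j%:R)) ^+ 2
  = n%:R * (a ^+ 2 + b ^+ 2) / 2.
Proof.
move=> n0 nk; have [hc hs] := sum_cos_sin_theta0 n0 nk.
transitivity (\sum_(j < n) ((a ^+ 2 + b ^+ 2) / 2
   + (a ^+ 2 - b ^+ 2) / 2 * cos (theta n k.*2 * j%:R)
   + a * b * sin (theta n k.*2 * j%:R))).
  apply: eq_bigr => j _; rewrite theta_double cos_mulr2n sin_mulr2n.
  rewrite sqrrD exprMn [(b * sin _) ^+ 2]exprMn sin2cos2.
  move: (cos _) (sin _) => c s.
  by field.
rewrite !big_split/= -!mulr_sumr hc hs !mulr0 !addr0 sumr_const card_ord.
by rewrite -mulr_natl; field.
Qed.

End periodic_sums.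

(** * Lower bounds for sums of [1 - cos] of a trigonometric form *)

Section trigonometric_form.
Context {R : realType}.
Implicit Types (a b : R) (n k j : nat).

Lemma norm_le1_sqr (x : R) : x ^+ 2 <= 1 -> `|x| <= 1.
Proof. by rewrite -(@expr_le1 _ 2 `|x|)// real_normK ?num_real. Qed.

(** The coefficient of [x j] in [a * dft_re n k x + b * dft_im n k x], through which the
    characteristic function of an eigenvalue is expressed. *)
Definition trig_form n k a b j : R :=
  a * cos (theta n k * j%:R) + b * sin (theta n k * j%:R).

Lemma trig_form_sqr_le n k a b j : trig_form n k a b j ^+ 2 <= a ^+ 2 + b ^+ 2.
Proof.
rewrite /trig_form; set c := cos _; set s := sin _.
have h : c ^+ 2 + s ^+ 2 = 1 := cos2Dsin2 _.
have e : (a ^+ 2 + b ^+ 2) * (c ^+ 2 + s ^+ 2) - (a * c + b * s) ^+ 2 =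
         (a * s - b * c) ^+ 2 by ring.
by rewrite h mulr1 in e; rewrite -subr_ge0 e sqr_ge0.
Qed.

Lemma trig_form_period n k a b j : (0 < n)%N ->
  trig_form n k a b (j + n) = trig_form n k a b j.
Proof.
move=> n0; rewrite /trig_form.
by have := cos_thetaD k j (0 : R) n0; have := sin_thetaD k j (0 : R) n0; rewrite !addr0 => -> ->.
Qed.

(** Every value of the form is at most 1 in absolute value, so each summand dominates a quarter of
    the square, and the squares have a closed sum. *)
Lemma sum_one_minus_cos_small n k a b : (0 < n)%N -> ~~ (n %| k.*2)%N ->
  a ^+ 2 + b ^+ 2 <= 1 ->
  n%:R * (a ^+ 2 + b ^+ 2) / 8 <= \sum_(j < n) (1 - cos (trig_form n k a b j)).
Proof.
move=> n0 nk ab1.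
have -> : n%:R * (a ^+ 2 + b ^+ 2) / 8 =
    \sum_(j < n) trig_form n k a b j ^+ 2 / 4.
  by rewrite -mulr_suml sum_sqr_trig//; field.
apply: ler_sum => j _; apply: one_minus_cos_ge.
by apply: norm_le1_sqr; exact: le_trans (trig_form_sqr_le _ _ _ _ _) ab1.
Qed.

Lemma nat_multiple_half_unit (x : R) : 0 < x <= 1 ->
  exists l : nat, 1 / 2 <= l%:R * x <= 1.
Proof.
move=> /andP[x0 x1]; exists (Num.truncn x^-1).
have xV : 0 <= x^-1 by rewrite invr_ge0 ltW.
have /andP[h1 h2] := truncn_itv xV.
have l1 : (1 : R) <= (Num.truncn x^-1)%:R.
  by rewrite ler1n truncn_gt0 -(@invr1 R) lef_pV2 ?posrE.
have e : x^-1 * x = 1 by rewrite mulVf ?gt_eqF.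
move: h2; rewrite -natr1 => h2.
apply/andP; split; last by rewrite -[leRHS]e ler_pM2r.
have : x^-1 * x < ((Num.truncn x^-1)%:R + 1) * x by rewrite ltr_pM2r.
rewrite e; nra.
Qed.

(* Subtracting from the form its translate by [u * l] gives a form whose
   coefficient vector has norm in [1/sqrt 8, 1]; the order [n / gcd (k, n)] must
   be large for such a translate to exist. *)
Lemma sum_one_minus_cos_large n k a b : (0 < n)%N -> ~~ (n %| k.*2)%N ->
  1 <= a ^+ 2 + b ^+ 2 ->
  64 * (a ^+ 2 + b ^+ 2) * (gcdn k n)%:R ^+ 2 <= n%:R ^+ 2 ->
  n%:R / 256 <= \sum_(j < n) (1 - cos (trig_form n k a b j)).
Proof.
move=> n0 nk ab1 gn; set g := gcdn k n in gn *.
have k0 : (0 < k)%N by case: (k) nk => //; rewrite dvdn0.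
have g0 : (0 < g)%N by rewrite gcdn_gt0 k0.
have nR : 0 < n%:R :> R by rewrite ltr0n.
have gR : 0 < g%:R :> R by rewrite ltr0n.
set r := Num.sqrt (a ^+ 2 + b ^+ 2).
have r2 : r ^+ 2 = a ^+ 2 + b ^+ 2 by rewrite sqr_sqrtr// (le_trans _ ab1).
have r1 : 1 <= r by rewrite -sqrtr1 ler_sqrt// (le_trans _ ab1).
(* The constant 64 is the square of 8, which bounds [2 * pi]; this makes [r * eta1 <= 1] below. *)
have gn' : 8 * r * g%:R <= n%:R.
  have h0 : 0 <= 8 * r * g%:R by rewrite !mulr_ge0// (le_trans _ r1).
  rewrite -ler_sqr; [|by rewrite nnegrE|by rewrite nnegrE ltW].
  apply: le_trans gn.
  by rewrite -r2 le_eqVlt; apply/orP; left; apply/eqP; ring.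
have pi4 : pi < 4 :> R by have := @pihalf_lt2 R; lra.
have pi0 := @pi_gt0 R.
pose eta1 : R := pi *+ 2 * g%:R / n%:R.
have eta10 : 0 < eta1 by rewrite /eta1 divr_gt0// mulr_gt0// pmulrn_rgt0.
have [|l /andP[l1 l2]] := @nat_multiple_half_unit (r * eta1).
  rewrite mulr_gt0 ?(lt_le_trans _ r1)//= /eta1 mulrA ler_pdivrMr// mul1r.
  apply: le_trans gn'; rewrite -mulr_natr.
  have : 0 < r * g%:R by rewrite mulr_gt0// (lt_le_trans _ r1).
  nra.
pose eta := l%:R * eta1.
have le1 : 1 / 2 <= r * eta by rewrite /eta mulrCA.
have le2 : r * eta <= 1 by rewrite /eta mulrCA.
have eta0 : 0 <= eta by rewrite mulr_ge0// ltW.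
have eta1' : eta <= 1 by apply: le_trans le2; rewrite ler_peMl.
(* Bezout's relation turns a shift of the index by [u * l] into a rotation by [eta] modulo
   [2 * pi]. *)
case: (egcdnP n k0) => u v uv _.
have thm : theta n k * (u * l)%:R = eta + pi *+ 2 *+ (v * l).
  rewrite /theta /eta /eta1.
  have : (u%:R * k%:R = v%:R * n%:R + g%:R :> R) by rewrite -!natrM uv natrD natrM.
  rewrite -[_ *+ (v * l)]mulr_natr !natrM => h.
  have -> : pi *+ 2 * k%:R / n%:R * (u%:R * l%:R) =
    pi *+ 2 * (u%:R * k%:R) / n%:R * l%:R :> R by ring.
  by rewrite h; field; rewrite gt_eqF.
(* The vector [(a', b')] is [(a, b)] minus its rotation by [eta]; its squared norm, r^2 times 2 (1 -
   cos eta), lies between (r eta)^2 / 2 and (r eta)^2. *)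
pose a' := a - (a * cos eta + b * sin eta).
pose b' := b - (b * cos eta - a * sin eta).
have shift j : trig_form n k a' b' j =
    trig_form n k a b j - trig_form n k a b (j + u * l).
  rewrite /trig_form natrD mulrDr thm addrA.
  have -> : cos (theta n k * j%:R + eta + pi *+ 2 *+ (v * l)) =
            cos (theta n k * j%:R + eta) by rewrite (periodicn (@cosD2pi R)).
  have -> : sin (theta n k * j%:R + eta + pi *+ 2 *+ (v * l)) =
            sin (theta n k * j%:R + eta) by rewrite (periodicn (@sinD2pi R)).
  by rewrite cosD sinD /a' /b'; ring.
have ab' : a' ^+ 2 + b' ^+ 2 = r ^+ 2 * (2 * (1 - cos eta)).
  rewrite /a' /b' r2; set c := cos _; set s := sin _.
  have h : c ^+ 2 + s ^+ 2 = 1 := cos2Dsin2 _.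
  transitivity ((a ^+ 2 + b ^+ 2) * (1 - 2 * c + (c ^+ 2 + s ^+ 2))); first by ring.
  by rewrite h; ring.
have re : 1 / 4 <= (r * eta) ^+ 2 <= 1.
  have re0 : 0 <= r * eta by lra.
  by apply/andP; split; [nra|rewrite expr_le1].
have ceta := one_minus_cos_le eta.
have := @one_minus_cos_ge _ eta; rewrite ger0_norm// => /(_ eta1') ceta'.
have r20 : 0 <= r ^+ 2 by rewrite sqr_ge0.
have ab'1 : a' ^+ 2 + b' ^+ 2 <= 1.
  rewrite ab'; move/andP : re => [_]; apply: le_trans.
  by rewrite exprMn ler_wpM2l//; lra.
have ab'2 : 1 / 8 <= a' ^+ 2 + b' ^+ 2.
  rewrite ab'; move/andP : re => [re _].
  have : (r * eta) ^+ 2 / 2 <= r ^+ 2 * (2 * (1 - cos eta)).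
    by rewrite exprMn -mulrA ler_wpM2l//; lra.
  lra.
have h1 := sum_one_minus_cos_small n0 nk ab'1.
(* By periodicity both translates contribute the same sum, hence the factor 4; with the two factors
   1/8 it produces 1/256. *)
have h2 : \sum_(j < n) (1 - cos (trig_form n k a' b' j)) <=
    4 * \sum_(j < n) (1 - cos (trig_form n k a b j)).
  have -> : 4 * \sum_(j < n) (1 - cos (trig_form n k a b j)) =
      \sum_(j < n) (2 * (1 - cos (trig_form n k a b j)) +
                    2 * (1 - cos (trig_form n k a b (j + u * l)))).
    rewrite [RHS]big_split/= -!mulr_sumr.
    rewrite (@sum_shift_periodic _ n (fun j => 1 - cos (trig_form n k a b j))).
      by rewrite -mulrDl; congr (_ * _); rewrite -natrD.
    by move=> j; rewrite trig_form_period.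
  by apply: ler_sum => j _; rewrite shift one_minus_cosB.
have h3 : n%:R / 64 <= n%:R * (a' ^+ 2 + b' ^+ 2) / 8.
  have : n%:R * (1 / 8) <= n%:R * (a' ^+ 2 + b' ^+ 2) by rewrite ler_pM2l.
  lra.
lra.
Qed.

Lemma sum_one_minus_cos_ge n k a b : (0 < n)%N -> ~~ (n %| k.*2)%N ->
  a ^+ 2 + b ^+ 2 <= 1 \/
  64 * (a ^+ 2 + b ^+ 2) * (gcdn k n)%:R ^+ 2 <= n%:R ^+ 2 ->
  n%:R / 256 * Num.min 1 (a ^+ 2 + b ^+ 2) <=
  \sum_(j < n) (1 - cos (trig_form n k a b j)).
Proof.
move=> n0 nk; have nR : 0 < n%:R :> R by rewrite ltr0n.
have [ab1 _|ab1 [|h]] := leP (a ^+ 2 + b ^+ 2) 1.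
- have := sum_one_minus_cos_small n0 nk ab1; apply: le_trans.
  by have : 0 <= a ^+ 2 + b ^+ 2 by [rewrite addr_ge0 ?sqr_ge0]; nra.
- by [].
- by rewrite mulr1; apply: (sum_one_minus_cos_large n0 nk (ltW ab1) h).
Qed.

(** Here [theta n k] is a multiple of [pi], so the form takes only the values [a] and [- a] and
    nothing controls [b]. *)
Lemma sum_one_minus_cos_real n k a b : (0 < n)%N -> (n %| k.*2)%N ->
  a ^+ 2 <= 1 ->
  n%:R / 256 * a ^+ 2 <= \sum_(j < n) (1 - cos (trig_form n k a b j)).
Proof.
move=> n0 /dvdnP[c kc] a1; have nR : 0 < n%:R :> R by rewrite ltr0n.
have thE j : theta n k * j%:R = pi *+ (c * j) :> R.
  rewrite /theta -[_ *+ (c * j)]mulr_natr natrM.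
  have : (k%:R * 2 = c%:R * n%:R :> R) by rewrite -natrM muln2 kc natrM.
  by move=> h; have -> : k%:R = c%:R * n%:R / 2 :> R by [lra]; field; rewrite gt_eqF.
have s0 j : sin (theta n k * j%:R) = 0 :> R.
  by rewrite thE -[pi *+ _]add0r (alternatingn (@sinDpi R)) sin0 mulr0.
have -> : n%:R / 256 * a ^+ 2 = \sum_(j < n) (a ^+ 2 / 256).
  by rewrite sumr_const card_ord -[RHS]mulr_natl; ring.
have tE j : trig_form n k a b j ^+ 2 = a ^+ 2.
  by rewrite /trig_form s0 mulr0 addr0 exprMn cos2sin2 s0 expr0n subr0 mulr1.
apply: ler_sum => j _; apply: (@le_trans _ _ (trig_form n k a b j ^+ 2 / 4)).
  by rewrite tE; have := sqr_ge0 a; lra.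
by apply: one_minus_cos_ge; apply: norm_le1_sqr; rewrite tE.
Qed.

End trigonometric_form.

(** With g the gcd of [k] and [n], the reduced fraction (k/g) / (n/g) determines [k], and its
    numerator and denominator are both at most [Q]. *)
Lemma card_small_order n Q : (0 < n)%N ->
  (#|[pred k : 'I_n | (n <= Q * gcdn k n)%N]| <= Q.+1 ^ 2)%N.
Proof.
move=> n0; set A := [pred k | _].
pose f (k : 'I_n) : 'I_Q.+1 * 'I_Q.+1 :=
  (inord (n %/ gcdn k n), inord (k %/ gcdn k n)).
have fi : {in A &, injective f}.
  move=> k l; rewrite !inE => kA lA [].
  have gk0 : (0 < gcdn k n)%N by rewrite gcdn_gt0 n0 orbT.
  have gl0 : (0 < gcdn l n)%N by rewrite gcdn_gt0 n0 orbT.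
  have bound (m : 'I_n) : (n <= Q * gcdn m n)%N -> (0 < gcdn m n)%N ->
      (n %/ gcdn m n < Q.+1)%N /\ (m %/ gcdn m n < Q.+1)%N.
    move=> mA g0; have h : (n %/ gcdn m n <= Q)%N.
      by rewrite -(mulnK Q g0) leq_div2r.
    by split; rewrite ltnS//; apply: leq_trans h; rewrite leq_div2r// ltnW.
  have [bk1 bk2] := bound _ kA gk0; have [bl1 bl2] := bound _ lA gl0.
  move=> /(congr1 val); rewrite /= !inordK// => e1.
  move=> /(congr1 val); rewrite /= !inordK// => e2.
  have eg : gcdn k n = gcdn l n.
    have d0 : (0 < n %/ gcdn l n)%N by rewrite divn_gt0// dvdn_leq// dvdn_gcdr.
    apply/eqP; rewrite -(eqn_pmul2l d0) -{1}e1 !divnK ?dvdn_gcdr//.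
  apply: val_inj => /=; rewrite -(divnK (dvdn_gcdl k n)) e2 eg.
  by rewrite divnK// dvdn_gcdl.
rewrite -(card_in_imset fi) (leq_trans (max_card _))//.
by rewrite card_prod card_ord.
Qed.

(** * Spectrum of the Gram matrix of a circulant matrix *)

Section circulant_spectrum.
Context {R : realType}.
Implicit Types (x : nat -> R) (n k : nat).

Definition dft_re n k x : R := \sum_(j < n) x j * cos (theta n k * j%:R).
Definition dft_im n k x : R := \sum_(j < n) x j * sin (theta n k * j%:R).
Definition dft_sqr n k x : R := dft_re n k x ^+ 2 + dft_im n k x ^+ 2.

(** Real and imaginary parts of the Fourier vector. A real circulant matrix mixes the two like a
    complex multiplication, while its Gram matrix multiplies both by the same scalar. *)
Definition cosv n k : 'cV[R]_n := \col_i cos (theta n k * i%:R).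
Definition sinv n k : 'cV[R]_n := \col_i sin (theta n k * i%:R).

(** Each row is a cyclic shift of [x], so reindexing by [j - i] modulo [n] turns the product into a
    correlation; [G] will be the cosine or the sine. *)
Lemma circulant_conv n k x (G : R -> R) (i : 'I_n) :
  (forall y, G (y + theta n k * n%:R) = G y) ->
  \sum_(j < n) circulant n x i j * G (theta n k * j%:R) =
  \sum_(m < n) x m * G (theta n k * m%:R + theta n k * i%:R).
Proof.
move=> per; have ni := ltnW (ltn_ord i).
pose F l := x (l %% n)%N * G (theta n k * l%:R + theta n k * i%:R).
transitivity (\sum_(j < n) F (j + (n - i))%N).
  apply: eq_bigr => j _; rewrite /circulant mxE /F addnBA//; congr (_ * _).
  by rewrite -mulrDr -natrD subnK ?(leq_trans ni) ?leq_addl// natrD mulrDr per.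
rewrite sum_shift_periodic.
  by apply: eq_bigr => m _; rewrite /F modn_small.
by move=> l; rewrite /F modnDr natrD mulrDr addrAC per.
Qed.

Lemma circulant_tr_conv n k x (G : R -> R) (i : 'I_n) :
  (forall y, G (y + theta n k * n%:R) = G y) ->
  \sum_(j < n) (circulant n x)^T i j * G (theta n k * j%:R) =
  \sum_(m < n) x m * G (theta n k * i%:R - theta n k * m%:R).
Proof.
move=> per; have n0 : (0 < n)%N by case: (n) i => // -[].
pose F l := x (l %% n)%N * G (theta n k * i%:R - theta n k * l%:R).
(* In the transpose the index of [x] decreases with [j]; reversing [j] into [n - 1 - j] makes it
   [j + i.+1], again a plain shift. *)
rewrite (reindex_inj rev_ord_inj)/=.
transitivity (\sum_(j < n) F (j + i.+1)%N).
  apply: eq_bigr => j _; rewrite !mxE /F; congr (x _ * _).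
    congr (_ %% _)%N; have := ltn_ord j; have := ltn_ord i; rewrite /=; lia.
  rewrite -[LHS]per -[RHS]per -mulrDr -mulrBr.
  have jn := ltn_ord j.
  rewrite -[RHS]per; congr G; rewrite natrB// -addSnnS !natrD -(natr1 j); ring.
rewrite sum_shift_periodic.
  by apply: eq_bigr => m _; rewrite /F modn_small.
by move=> l; rewrite /F modnDr -[in LHS]per; congr (_ * G _); rewrite natrD; ring.
Qed.

Lemma circulant_cosv n k x : (0 < n)%N ->
  circulant n x *m cosv n k = dft_re n k x *: cosv n k - dft_im n k x *: sinv n k.
Proof.
move=> n0; apply/colP => i; rewrite !mxE.
under eq_bigr do rewrite [cosv _ _ _ _]mxE.
rewrite (@circulant_conv _ _ _ cos); last by move=> y; rewrite cos_theta_period.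
rewrite /dft_re /dft_im !mulr_suml -sumrB; apply: eq_bigr => m _.
by rewrite cosD; ring.
Qed.

Lemma circulant_sinv n k x : (0 < n)%N ->
  circulant n x *m sinv n k = dft_im n k x *: cosv n k + dft_re n k x *: sinv n k.
Proof.
move=> n0; apply/colP => i; rewrite !mxE.
under eq_bigr do rewrite [sinv _ _ _ _]mxE.
rewrite (@circulant_conv _ _ _ sin); last by move=> y; rewrite sin_theta_period.
rewrite /dft_re /dft_im !mulr_suml -big_split/=; apply: eq_bigr => m _.
by rewrite sinD; ring.
Qed.

Lemma circulant_tr_cosv n k x : (0 < n)%N ->
  (circulant n x)^T *m cosv n k =
  dft_re n k x *: cosv n k + dft_im n k x *: sinv n k.
Proof.
move=> n0; apply/colP => i; rewrite mxE [RHS]mxE !mxE.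
under eq_bigr do rewrite [cosv _ _ _ _]mxE.
rewrite (@circulant_tr_conv _ _ _ cos); last by move=> y; rewrite cos_theta_period.
rewrite /dft_re /dft_im !mulr_suml -big_split/=; apply: eq_bigr => m _.
by rewrite cosB; ring.
Qed.

Lemma circulant_tr_sinv n k x : (0 < n)%N ->
  (circulant n x)^T *m sinv n k =
  dft_re n k x *: sinv n k - dft_im n k x *: cosv n k.
Proof.
move=> n0; apply/colP => i; rewrite mxE [RHS]mxE !mxE.
under eq_bigr do rewrite [sinv _ _ _ _]mxE.
rewrite (@circulant_tr_conv _ _ _ sin); last by move=> y; rewrite sin_theta_period.
rewrite /dft_re /dft_im !mulr_suml -sumrB; apply: eq_bigr => m _.
by rewrite sinB; ring.
Qed.

Lemma gram_circulant_cosv n k x : (0 < n)%N ->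
  (circulant n x)^T *m circulant n x *m cosv n k = dft_sqr n k x *: cosv n k.
Proof.
move=> n0; rewrite -mulmxA circulant_cosv// mulmxBr -!scalemxAr.
rewrite circulant_tr_cosv// circulant_tr_sinv//.
by apply/colP => i; rewrite !mxE /dft_sqr; ring.
Qed.

Lemma gram_circulant_sinv n k x : (0 < n)%N ->
  (circulant n x)^T *m circulant n x *m sinv n k = dft_sqr n k x *: sinv n k.
Proof.
move=> n0; rewrite -mulmxA circulant_sinv// mulmxDr -!scalemxAr.
rewrite circulant_tr_cosv// circulant_tr_sinv//.
by apply/colP => i; rewrite !mxE /dft_sqr; ring.
Qed.

(** Fourier inversion: the relations at [k], weighted by the cosine and sine of [theta n k * i%:R]
    and summed over [k], leave [n] times the entry [i]. The other entries cancel because frequency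
    and index play symmetric roles in [theta]. *)
Lemma dft_inversion n (v : 'rV[R]_n) :
  (forall k : 'I_n, v *m cosv n k = 0 /\ v *m sinv n k = 0) -> v = 0.
Proof.
move=> h; apply/rowP => i; rewrite mxE.
have n0 : (0 < n)%N by case: (n) i {v h} => // -[].
have e (k : 'I_n) : \sum_(j < n) v 0 j * cos (theta n k * j%:R - theta n k * i%:R) = 0.
  have [/rowP/(_ 0) hc /rowP/(_ 0) hs] := h k.
  move: hc hs; rewrite !mxE => hc hs.
  transitivity (cos (theta n k * i%:R) * (\sum_j v 0 j * cosv n k j 0) +
                sin (theta n k * i%:R) * (\sum_j v 0 j * sinv n k j 0)).
    rewrite !mulr_sumr -big_split/=; apply: eq_bigr => j _.
    by rewrite !mxE cosB; ring.
  by rewrite hc hs !mulr0 addr0.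
have : \sum_(k < n) \sum_(j < n) v 0 j * cos (theta n k * j%:R - theta n k * i%:R) = 0.
  by apply: big1 => k _; exact: e.
rewrite exchange_big/= (bigD1 i)//= [X in _ + X]big1 => [|j ji].
  rewrite addr0; under eq_bigr do rewrite subrr cos0 mulr1.
  rewrite sumr_const card_ord => /eqP; rewrite mulrn_eq0 -leqn0 leqNgt n0/=.
  by move/eqP.
rewrite -mulr_sumr; apply/eqP; rewrite mulf_eq0; apply/orP; right; apply/eqP.
wlog lij : i j {e} ji / (i < j)%N => [w|].
  move: (ji); rewrite neq_ltn => /orP[ij|ij]; last exact: w.
  by under eq_bigr do rewrite -cosN opprB; apply: w => //; rewrite eq_sym.
have nd : ~~ (n %| j - i)%N.
  apply/negP => /dvdn_leq; rewrite subn_gt0 => /(_ lij).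
  by have := ltn_ord j; lia.
rewrite -[RHS](proj1 (@sum_cos_sin_theta0 R n (j - i) n0 nd)).
apply: eq_bigr => k _; rewrite -mulrBr -natrB; last exact: ltnW.
by rewrite theta_swap.
Qed.

(** A row eigenvector for any other value would annihilate every [cosv] and [sinv], hence vanish by
    inversion. Conversely [cosv] is nonzero, its entry at index 0 being 1, and transposes to a row
    eigenvector since the Gram matrix is symmetric. *)
Lemma eigenvalue_gram_circulant n x (l : R) : (0 < n)%N ->
  eigenvalue ((circulant n x)^T *m circulant n x) l <->
  exists k : 'I_n, l = dft_sqr n k x.
Proof.
move=> n0; split=> [/eigenvalueP[v vA v0]|[k ->]].
  apply: contrapT => h; move/eqP : v0; apply.
  apply: dft_inversion => k.
  suff main (w : 'cV[R]_n) :
      (circulant n x)^T *m circulant n x *m w = dft_sqr n k x *: w -> v *m w = 0.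
    by split; apply: main; rewrite ?gram_circulant_cosv ?gram_circulant_sinv.
  move=> /(congr1 (mulmx v)); rewrite mulmxA vA -scalemxAl -scalemxAr => /eqP.
  rewrite -subr_eq0 -scalerBl scalemx_eq0 subr_eq0 => /orP[/eqP e|/eqP//].
  by exfalso; apply: h; exists k.
apply/eigenvalueP; exists (cosv n k)^T.
  have sym : ((circulant n x)^T *m circulant n x)^T =
    (circulant n x)^T *m circulant n x by rewrite trmx_mul trmxK.
  by rewrite -{1}sym -trmx_mul gram_circulant_cosv// linearZ.
apply/eqP => /rowP/(_ (Ordinal n0)); rewrite !mxE mulr0 cos0 => /eqP.
by rewrite oner_eq0.
Qed.

(** The spectrum is a finite nonempty set, so supremum and infimum are attained and the bound
    becomes pairwise. Strict positivity excludes the infinite value of [kappa]. *)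
Lemma kappa_circulant_le n x (c : R) : (0 < n)%N -> 0 <= c ->
  (kappa (circulant n x) <= c%:E)%E <->
  (forall k : 'I_n, 0 < dft_sqr n k x) /\
  (forall k l : 'I_n, Num.sqrt (dft_sqr n k x) <= c * Num.sqrt (dft_sqr n l x)).
Proof.
move=> n0 c0; rewrite /kappa /sigma_max /sigma_min.
set E := [set l | _].
have EE (k : 'I_n) : E (dft_sqr n k x) by apply/eigenvalue_gram_circulant => //; exists k.
pose i0 := Ordinal n0.
have [kM _ hM] := @Order.TotalTheory.arg_maxP _ _ _ i0 xpredT (fun k : 'I_n => dft_sqr n k x) isT.
have [km _ hm] := @Order.TotalTheory.arg_minP _ _ _ i0 xpredT (fun k : 'I_n => dft_sqr n k x) isT.
have En : E !=set0 by exists (dft_sqr n i0 x); exact: EE.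
have -> : sup E = dft_sqr n kM x.
  apply/eqP; rewrite eq_le; apply/andP; split.
    by apply: ge_sup => // _ /eigenvalue_gram_circulant -/(_ n0)[k ->]; exact: hM.
  apply: ub_le_sup => //; exists (dft_sqr n kM x).
  by move=> _ /eigenvalue_gram_circulant -/(_ n0)[k ->]; exact: hM.
have -> : inf E = dft_sqr n km x.
  apply/eqP; rewrite eq_le; apply/andP; split.
    apply: ge_inf => //; exists (dft_sqr n km x).
    by move=> _ /eigenvalue_gram_circulant -/(_ n0)[k ->]; exact: hm.
  by apply: lb_le_inf => // _ /eigenvalue_gram_circulant -/(_ n0)[k ->]; exact: hm.
have [s0|s0] := eqVneq (Num.sqrt (dft_sqr n km x)) 0.
  split=> [|[/(_ km) + _]]; first by rewrite leye_eq.
  by rewrite -sqrtr_gt0 s0 ltxx.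
have sp : 0 < Num.sqrt (dft_sqr n km x) by rewrite lt0r s0 sqrtr_ge0.
rewrite lee_fin ler_pdivrMr//; split=> [h|[_]]; last exact.
split=> [k|k l]; first by rewrite (lt_le_trans _ (hm k isT))// -sqrtr_gt0.
apply: (@le_trans _ _ (Num.sqrt (dft_sqr n kM x))).
  by apply: ler_wsqrtr; exact: hM.
by rewrite (le_trans h)// ler_wpM2l//; apply: ler_wsqrtr; exact: hm.
Qed.

End circulant_spectrum.

Import HBNNSimple.

(** * Extending a product rule from indicators to nonnegative functions *)

Section independence_step.
Context {R : realType} {d : measure_display} {T : measurableType d}.
Variable P : probability T R.
Implicit Types (G X : T -> R) (f : R -> R).

(** A simple function is a finite nonnegative combination of indicators of its level sets, so
    linearity suffices. *)
Lemma integral_indep_nnsfun G X (h : {nnsfun R >-> R}) :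
  measurable_fun setT G -> (forall w, 0 <= G w) -> measurable_fun setT X ->
  (forall B : set R, measurable B ->
    (\int[P]_w (G w * \1_B (X w))%:E =
     \int[P]_w (G w)%:E * \int[P]_w (\1_B (X w))%:E)%E) ->
  (\int[P]_w (G w * h (X w))%:E =
   \int[P]_w (G w)%:E * \int[P]_w (h (X w))%:E)%E.
Proof.
move=> mG G0 mX indep.
set s := fset_set (range h); set e := finmap.enum_fset s.
have e0 (i : 'I_(size e)) : 0 <= e`_i.
  have : e`_i \in e by rewrite mem_nth.
  by rewrite in_fset_set// inE => -[y _ <-].
have mI (i : 'I_(size e)) : measurable (h @^-1` [set e`_i]).
  exact: measurable_funPTI.
have m1 (i : 'I_(size e)) : measurable_fun setT (fun w => \1_(h @^-1` [set e`_i]) (X w) : R).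
  by apply: measurableT_comp => //; exact: measurable_indic.
have hE w : h (X w) = \sum_(i < size e) e`_i * \1_(h @^-1` [set e`_i]) (X w).
  by rewrite {1}(fimfunEord h).
transitivity (\sum_(i < size e) (e`_i)%:E *
    \int[P]_w (G w * \1_(h @^-1` [set e`_i]) (X w))%:E)%E.
  under eq_integral => w _ do rewrite hE mulr_sumr -sumEFin.
  rewrite ge0_integral_sum//=.
  - apply: eq_bigr => i _; rewrite -ge0_integralZl//.
    + by apply: eq_integral => w _; rewrite -EFinM; congr EFin; ring.
    + by apply/measurable_EFinP; exact: measurable_funM.
    + by move=> w _; rewrite lee_fin mulr_ge0.
    + by rewrite lee_fin.
  - move=> i; apply/measurable_EFinP; apply: measurable_funM => //.
    exact: measurable_funM.
  - by move=> i w _; rewrite lee_fin !mulr_ge0.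
transitivity (\int[P]_w (G w)%:E * \sum_(i < size e) (e`_i)%:E *
    \int[P]_w (\1_(h @^-1` [set e`_i]) (X w))%:E)%E.
  rewrite ge0_sume_distrr.
    by apply: eq_bigr => i _; rewrite indep// muleCA.
  move=> i _; rewrite mule_ge0 ?lee_fin//; apply: integral_ge0 => w _.
  by rewrite lee_fin.
congr (_ * _)%E.
under [RHS]eq_integral => w _ do rewrite hE -sumEFin.
rewrite ge0_integral_sum//=.
- apply: eq_bigr => i _; rewrite -ge0_integralZl ?lee_fin//.
  exact/measurable_EFinP.
- by move=> i; apply/measurable_EFinP; exact: measurable_funM.
- by move=> i w _; rewrite lee_fin !mulr_ge0.
Qed.

(** Monotone convergence along simple functions; finiteness of the integral of [G] makes
    multiplication by it continuous. *)
Lemma ge0_integral_indep G X f :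
  measurable_fun setT G -> (forall w, 0 <= G w) ->
  (\int[P]_w (G w)%:E < +oo)%E ->
  measurable_fun setT X ->
  (forall B : set R, measurable B ->
    (\int[P]_w (G w * \1_B (X w))%:E =
     \int[P]_w (G w)%:E * \int[P]_w (\1_B (X w))%:E)%E) ->
  measurable_fun setT f -> (forall x, 0 <= f x) ->
  (\int[P]_w (G w * f (X w))%:E =
   \int[P]_w (G w)%:E * \int[P]_w (f (X w))%:E)%E.
Proof.
move=> mG G0 Gfin mX indep mf f0.
have mEf : measurable_fun setT (EFin \o f) by exact/measurable_EFinP.
pose h := nnsfun_approx measurableT mEf.
have h_cvg x : (h n x)%:E @[n --> \oo] --> (f x)%:E.
  by apply: (cvg_nnsfun_approx measurableT mEf) => // y _; rewrite lee_fin.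
have h_nd x : {homo (fun n => h n x) : n m / (n <= m)%N >-> n <= m}.
  by move=> n m nm; have /lefP := @nd_nnsfun_approx _ _ _ _ measurableT _ mEf n m nm; exact.
have mh n : measurable_fun setT (fun w => h n (X w)).
  by apply: measurableT_comp => //; exact: measurable_funPT.
have cvgL : (\int[P]_w (G w * h n (X w))%:E)%E @[n --> \oo] -->
    (\int[P]_w (G w * f (X w))%:E)%E.
  have -> : (\int[P]_w (G w * f (X w))%:E)%E =
    (\int[P]_w limn (fun n => (G w * h n (X w))%:E))%E.
    apply: eq_integral => w _; apply/esym/cvg_lim => //.
    under eq_fun do rewrite EFinM.
    by rewrite EFinM; apply: cvgeZl.
  apply: cvg_monotone_convergence => //.
  - by move=> n; apply/measurable_EFinP; exact: measurable_funM.
  - by move=> n w _; rewrite lee_fin mulr_ge0.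
  - by move=> w _ n m nm; rewrite lee_fin ler_wpM2l// h_nd.
have cvgR : (\int[P]_w (h n (X w))%:E)%E @[n --> \oo] -->
    (\int[P]_w (f (X w))%:E)%E.
  have -> : (\int[P]_w (f (X w))%:E)%E =
    (\int[P]_w limn (fun n => (h n (X w))%:E))%E.
    by apply: eq_integral => w _; apply/esym/cvg_lim.
  apply: cvg_monotone_convergence => //.
  - by move=> n; exact/measurable_EFinP.
  - by move=> n w _; rewrite lee_fin.
  - by move=> w _ n m nm; rewrite lee_fin h_nd.
have cvgL' : (\int[P]_w (G w * h n (X w))%:E)%E @[n --> \oo] -->
    (\int[P]_w (G w)%:E * \int[P]_w (f (X w))%:E)%E.
  have -> : (fun n => \int[P]_w (G w * h n (X w))%:E)%E =
      (fun n => \int[P]_w (G w)%:E * \int[P]_w (h n (X w))%:E)%E.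
    by apply/funext => n; exact: integral_indep_nnsfun.
  apply: cvgeZl => //; rewrite ge0_fin_numE//.
  by apply: integral_ge0 => w _; rewrite lee_fin.
exact: (cvg_unique _ cvgL cvgL').
Qed.

End independence_step.

(** * Closure properties of bounded measurable functions *)

Section bounded_functions.
Context {R : realType} {d : measure_display} {T : measurableType d}.
Implicit Types (F G : T -> R) (c : R).

Definition bounded_mfun F :=
  measurable_fun setT F /\ exists C, forall w, `|F w| <= C.

Lemma bounded_mfun_cst c : bounded_mfun (fun=> c).
Proof. by split=> //; exists `|c|. Qed.

Lemma bounded_mfunD F G : bounded_mfun F -> bounded_mfun G ->
  bounded_mfun (fun w => F w + G w).
Proof.
move=> [mF [C FC]] [mG [D GD]]; split; first exact: measurable_funD.
by exists (C + D) => w; rewrite (le_trans (ler_normD _ _))// lerD.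
Qed.

Lemma bounded_mfunM F G : bounded_mfun F -> bounded_mfun G ->
  bounded_mfun (fun w => F w * G w).
Proof.
move=> [mF [C FC]] [mG [D GD]]; split; first exact: measurable_funM.
by exists (C * D) => w; rewrite normrM ler_pM.
Qed.

Lemma bounded_mfunZ c F : bounded_mfun F -> bounded_mfun (fun w => c * F w).
Proof. by move=> bF; apply: bounded_mfunM => //; exact: bounded_mfun_cst. Qed.

Lemma bounded_mfunN F : bounded_mfun F -> bounded_mfun (fun w => - F w).
Proof.
by move=> bF; under eq_fun do rewrite -mulN1r; exact: bounded_mfunZ.
Qed.

Lemma bounded_mfun_sum (I : Type) (s : seq I) (F : I -> T -> R) :
  (forall i, bounded_mfun (F i)) -> bounded_mfun (fun w => \sum_(i <- s) F i w).
Proof.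
move=> bF; elim: s => [|i s ih].
  by under eq_fun do rewrite big_nil; exact: bounded_mfun_cst.
by under eq_fun do rewrite big_cons; exact: bounded_mfunD.
Qed.

Lemma bounded_mfun_prod (I : Type) (s : seq I) (F : I -> T -> R) :
  (forall i, bounded_mfun (F i)) -> bounded_mfun (fun w => \prod_(i <- s) F i w).
Proof.
move=> bF; elim: s => [|i s ih].
  by under eq_fun do rewrite big_nil; exact: bounded_mfun_cst.
by under eq_fun do rewrite big_cons; exact: bounded_mfunM.
Qed.

Lemma bounded_mfun_indic (A : set T) : measurable A -> bounded_mfun \1_A.
Proof.
move=> mA; split; first exact: measurable_indic.
by exists 1 => w; rewrite indicE; case: (_ \in _); rewrite ?normr1 ?normr0.
Qed.

End bounded_functions.

Lemma bounded_mfun_comp {R : realType} {d d' : measure_display}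
  {T : measurableType d} {U : measurableType d'} (f : U -> R) (X : T -> U) :
  bounded_mfun f -> measurable_fun setT X -> bounded_mfun (fun w => f (X w)).
Proof.
by move=> [mf [C fC]] mX; split; [exact: measurableT_comp mf mX | exists C].
Qed.

(** * Expectations of bounded functions *)

Section bounded_expectation.
Context {R : realType} {d : measure_display} {T : measurableType d}.
Variable P : probability T R.
Implicit Types (F G X : T -> R) (f : R -> R) (c : R).

Lemma bounded_mfun_integrable F : bounded_mfun F ->
  P.-integrable setT (EFin \o F).
Proof.
move=> [mF [C FC]]; apply: measurable_bounded_integrable => //.
  exact: le_lt_trans (probability_le1 P measurableT) (ltry _).
by exists C; split; [exact: num_real | move=> M CM w _ /=; exact: le_trans (FC w) (ltW CM)].
Qed.

Lemma integral_bounded_mfunE F : bounded_mfun F ->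
  (\int[P]_w (F w)%:E)%E = (\int[P]_w F w)%:E.
Proof.
move=> bF; rewrite /Rintegral fineK//.
exact: (integrable_fin_num _ (bounded_mfun_integrable bF)).
Qed.

Lemma expect_boundedD F G : bounded_mfun F -> bounded_mfun G ->
  \int[P]_w (F w + G w) = \int[P]_w F w + \int[P]_w G w.
Proof. by move=> bF bG; rewrite RintegralD//; exact: bounded_mfun_integrable. Qed.

Lemma expect_boundedZ c F : bounded_mfun F ->
  \int[P]_w (c * F w) = c * \int[P]_w F w.
Proof. by move=> bF; rewrite RintegralZl//; exact: bounded_mfun_integrable. Qed.

Lemma expect_cst c : \int[P]_w c = c.
Proof. by rewrite Rintegral_cst// [X in fine X](probability_setT P) mulr1. Qed.

Lemma expect_bounded_sum (I : Type) (s : seq I) (F : I -> T -> R) :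
  (forall i, bounded_mfun (F i)) ->
  \int[P]_w (\sum_(i <- s) F i w) = \sum_(i <- s) \int[P]_w F i w.
Proof.
move=> bF; elim: s => [|i s ih].
  by rewrite big_nil; under eq_Rintegral do rewrite big_nil; rewrite expect_cst.
rewrite big_cons -ih -expect_boundedD//; last exact: bounded_mfun_sum.
by apply: eq_Rintegral => w _; rewrite big_cons.
Qed.

Lemma expect_bounded_le F G : bounded_mfun F -> bounded_mfun G ->
  (forall w, F w <= G w) -> \int[P]_w F w <= \int[P]_w G w.
Proof. by move=> bF bG FG; apply: le_Rintegral => //; exact: bounded_mfun_integrable. Qed.

Lemma expect_indic (A : set T) : measurable A ->
  \int[P]_w \1_A w = fine (P A).
Proof. by move=> mA; rewrite /Rintegral integral_indic// setIT. Qed.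

(** Adding the bounds [C] and [D] makes both factors nonnegative, so the previous case applies; the
    extra terms agree on both sides. *)
Lemma expect_indep_bounded G X f :
  bounded_mfun G -> measurable_fun setT X -> bounded_mfun f ->
  (forall B : set R, measurable B ->
    \int[P]_w (G w * \1_B (X w)) = \int[P]_w G w * \int[P]_w \1_B (X w)) ->
  \int[P]_w (G w * f (X w)) = \int[P]_w G w * \int[P]_w f (X w).
Proof.
move=> bG mX bf indep.
have [_ [C GC]] := bG; have [_ [D fD]] := bf.
have bfX := bounded_mfun_comp bf mX.
have bG' := bounded_mfunD bG (bounded_mfun_cst C).
have bf' := bounded_mfunD bf (bounded_mfun_cst D).
have bf'X := bounded_mfun_comp bf' mX.
have b1 (B : set R) : measurable B -> bounded_mfun (fun w => \1_B (X w) : R).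
  by move=> mB; apply: (bounded_mfun_comp (bounded_mfun_indic mB)).
have E1 : \int[P]_w (G w + C) = \int[P]_w G w + C.
  by rewrite expect_boundedD ?expect_cst//; exact: bounded_mfun_cst.
have E2 : \int[P]_w (f (X w) + D) = \int[P]_w f (X w) + D.
  by rewrite expect_boundedD ?expect_cst//; exact: bounded_mfun_cst.
have := @ge0_integral_indep _ _ _ P (fun w => G w + C) X (fun x => f x + D).
rewrite (integral_bounded_mfunE bG') (integral_bounded_mfunE bf'X).
rewrite (integral_bounded_mfunE (bounded_mfunM bG' bf'X)) -EFinM E1 E2.
have -> : \int[P]_w ((G w + C) * (f (X w) + D)) =
    \int[P]_w (G w * f (X w)) + D * \int[P]_w G w + C * \int[P]_w f (X w) + C * D.
  transitivity (\int[P]_w (G w * f (X w) + D * G w + C * f (X w) + C * D)).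
    by apply: eq_Rintegral => w _; ring.
  have bGf := bounded_mfunM bG bfX.
  have bDG := bounded_mfunZ D bG.
  have bCf := bounded_mfunZ C bfX.
  rewrite expect_boundedD; [|exact: bounded_mfunD (bounded_mfunD bGf bDG) bCf|exact: bounded_mfun_cst].
  rewrite expect_cst.
  rewrite expect_boundedD; [|exact: bounded_mfunD bGf bDG|by []].
  by rewrite expect_boundedD// !expect_boundedZ.
move=> H; have {H} : (\int[P]_w (G w * f (X w)) + D * \int[P]_w G w +
    C * \int[P]_w f (X w) + C * D)%:E =
  ((\int[P]_w G w + C) * (\int[P]_w f (X w) + D))%:E :> \bar R.
  apply: H => //.
  - by case: bG'.
  - by move=> w; have := GC w; rewrite ler_norml => /andP[]; rewrite -lerBlDr sub0r.
  - by rewrite ltry.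
  - move=> B mB.
    rewrite (integral_bounded_mfunE (b1 _ mB)).
    rewrite (integral_bounded_mfunE (bounded_mfunM bG' (b1 _ mB))) -EFinM.
    congr EFin; rewrite mulrDl -indep//.
    rewrite -expect_boundedZ; last exact: b1.
    rewrite -expect_boundedD; [|exact: bounded_mfunM bG (b1 _ mB)|exact/bounded_mfunZ/b1].
    by apply: eq_Rintegral => w _; rewrite mulrDl.
  - by case: bf'.
  - by move=> x; have := fD x; rewrite ler_norml => /andP[]; rewrite -lerBlDr sub0r.
move=> [] /eqP; rewrite -subr_eq0 => /eqP h.
apply/eqP; rewrite -subr_eq0 -h; apply/eqP; ring.
Qed.

End bounded_expectation.

(** * Independence and equality in law of the sequence, at the level of expectations *)

Section iid_expectations.
Context {R : realType} {d : measure_display} {T : measurableType d}.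
Variables (P : probability T R) (xi : nat -> {RV P >-> R}).
Hypothesis iid : iid_seq xi.
Implicit Types (F G : T -> R) (f g : R -> R) (n : nat).

Let mxi n : measurable_fun setT (xi n : T -> R).
Proof. exact: measurable_funPT. Qed.

Lemma prod_indic_preimage m (B : nat -> set R) w :
  \prod_(i < m) \1_(B i) (xi i w) =
  \1_(\big[setI/setT]_(i < m) (xi i @^-1` B i)) w :> R.
Proof.
elim: m => [|m ih]; first by rewrite !big_ord0 indicT.
by rewrite !big_ord_recr/= ih indicI.
Qed.

Let m_preim m (B : nat -> set R) : (forall i, measurable (B i)) ->
  measurable (\big[setI/setT]_(i < m) (xi i @^-1` B i)).
Proof.
move=> mB; elim: m => [|m ih]; first by rewrite big_ord0.
by rewrite big_ord_recr/=; apply: measurableI => //; exact: measurable_funPTI.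
Qed.

Let expect_indic_xi k (B : set R) : measurable B ->
  \int[P]_w \1_B (xi k w) = fine (P (xi k @^-1` B)).
Proof.
by move=> mB; rewrite -expect_indic//; exact: measurable_funPTI.
Qed.

Let bounded_indic_xi k (B : set R) : measurable B ->
  bounded_mfun (fun w => \1_B (xi k w) : R).
Proof. by move=> mB; apply: (bounded_mfun_comp (bounded_mfun_indic mB)). Qed.

Lemma expect_prod_indic m (B : nat -> set R) : (forall i, measurable (B i)) ->
  \int[P]_w (\prod_(i < m) \1_(B i) (xi i w)) =
  \prod_(i < m) \int[P]_w \1_(B i) (xi i w).
Proof.
move=> mB; under eq_Rintegral do rewrite prod_indic_preimage.
rewrite expect_indic ?iid.1//; last exact: m_preim.
under [RHS]eq_bigr do rewrite expect_indic_xi//.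
elim: m => [|m ih]; first by rewrite !big_ord0.
rewrite !big_ord_recr/= fineM ?ih//.
  rewrite -iid.1//; apply: fin_num_measure; exact: m_preim.
by apply: fin_num_measure; exact: measurable_funPTI.
Qed.

(* [F] is independent of [xi n], [xi n.+1], and so on: the factorization is
   only required against products of indicators. *)
Definition indep_tail n F := bounded_mfun F /\
  forall m (B : nat -> set R), (forall i, measurable (B i)) ->
  \int[P]_w (F w * \prod_(i < m) \1_(B i) (xi (n + i)%N w)) =
  \int[P]_w F w * \prod_(i < m) \int[P]_w \1_(B i) (xi (n + i)%N w).

Lemma indep_tail0 : indep_tail 0 (fun=> 1).
Proof.
split; first exact: bounded_mfun_cst.
move=> m B mB; rewrite expect_cst mul1r -expect_prod_indic//.
by apply: eq_Rintegral => w _; rewrite mul1r.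
Qed.

Lemma indep_tailD n F G : indep_tail n F -> indep_tail n G ->
  indep_tail n (fun w => F w + G w).
Proof.
move=> [bF hF] [bG hG]; split; first exact: bounded_mfunD.
move=> m B mB; rewrite expect_boundedD// mulrDl -hF// -hG//.
have bB : bounded_mfun (fun w => \prod_(i < m) \1_(B i) (xi (n + i)%N w) : R).
  by apply: bounded_mfun_prod => i; exact: bounded_indic_xi.
rewrite -expect_boundedD; [|exact: bounded_mfunM..].
by apply: eq_Rintegral => w _; rewrite mulrDl.
Qed.

Lemma indep_tailN n F : indep_tail n F -> indep_tail n (fun w => - F w).
Proof.
move=> [bF hF]; split; first exact: bounded_mfunN.
move=> m B mB; have EN H : bounded_mfun H -> \int[P]_w (- H w) = - \int[P]_w H w.
  by move=> bH; rewrite -mulN1r -expect_boundedZ//; apply: eq_Rintegral => w _; rewrite mulN1r.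
rewrite EN// mulNr -hF// -EN; first by apply: eq_Rintegral => w _; rewrite mulNr.
by apply: bounded_mfunM => //; apply: bounded_mfun_prod => i; exact: bounded_indic_xi.
Qed.

(** One inductive step of independence: [F] absorbs a function of [xi n] and stays independent of
    the later variables. *)
Lemma indep_tailM n F g : indep_tail n F -> bounded_mfun g ->
  indep_tail n.+1 (fun w => F w * g (xi n w)) /\
  \int[P]_w (F w * g (xi n w)) = \int[P]_w F w * \int[P]_w g (xi n w).
Proof.
move=> [bF hF] bg.
have bgX : bounded_mfun (fun w => g (xi n w)) by exact: bounded_mfun_comp bg (mxi n).
have key m (B : nat -> set R) : (forall i, measurable (B i)) ->
    \int[P]_w (F w * g (xi n w) * \prod_(i < m) \1_(B i) (xi (n.+1 + i)%N w)) =
    \int[P]_w F w * \prod_(i < m) \int[P]_w \1_(B i) (xi (n.+1 + i)%N w) *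
    \int[P]_w g (xi n w).
  move=> mB; set Q := fun w => \prod_(i < m) \1_(B i) (xi (n.+1 + i)%N w) : R.
  set q := \prod_(i < m) _.
  have bQ : bounded_mfun Q by apply: bounded_mfun_prod => i; exact: bounded_indic_xi.
  have hB B' : measurable B' -> \int[P]_w (F w * Q w * \1_B' (xi n w)) =
      \int[P]_w F w * q * \int[P]_w \1_B' (xi n w).
    (* Prepending the event on [xi n] to the later ones shows that [F] times the later indicators is
       independent of [xi n]. *)
    move=> mB'; pose B'' i := if i is j.+1 then B j else B'.
    have mB'' i : measurable (B'' i) by case: i => //=.
    have := hF m.+1 B'' mB''; rewrite big_ord_recl/= addn0 => e.
    transitivity (\int[P]_w (F w * \prod_(i < m.+1) \1_(B'' i) (xi (n + i)%N w))).
      apply: eq_Rintegral => w _; rewrite big_ord_recl/= addn0 -mulrA; congr (_ * _).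
      rewrite mulrC; congr (_ * _); apply: eq_bigr => i _.
      by rewrite /bump/= add1n addnS addSn.
    rewrite e mulrA mulrAC; congr (_ * _ * _); apply: eq_bigr => i _.
    by rewrite /bump/= add1n addnS addSn.
  have EG : \int[P]_w (F w * Q w) = \int[P]_w F w * q.
    have := hB setT measurableT.
    under eq_Rintegral do rewrite indicT mulr1.
    under [X in _ = _ * X]eq_Rintegral do rewrite indicT.
    by rewrite expect_cst mulr1.
  rewrite -EG -expect_indep_bounded//.
  - by apply: eq_Rintegral => w _; rewrite mulrAC.
  - exact: bounded_mfunM.
  - by move=> B' mB'; rewrite hB// EG.
have e0 : \int[P]_w (F w * g (xi n w)) = \int[P]_w F w * \int[P]_w g (xi n w).
  have := key 0%N (fun=> setT) (fun=> measurableT).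
  by under eq_Rintegral do rewrite big_ord0 mulr1; rewrite big_ord0 mulr1.
split => //; split; first exact: bounded_mfunM.
by move=> m B mB; rewrite key// e0 mulrAC.
Qed.

Lemma integral_id_distrib k (f : R -> \bar R) : measurable_fun setT f ->
  P.-integrable setT (f \o xi k) -> P.-integrable setT (f \o xi 0%N) ->
  (\int[P]_w f (xi k w) = \int[P]_w f (xi 0%N w))%E.
Proof.
move=> mf ik i0.
rewrite -[LHS]integral_distribution// -[RHS]integral_distribution//.
by apply: eq_measure_integral => A mA _; exact: iid.2.
Qed.

Lemma ge0_integral_id_distrib k (f : R -> \bar R) : measurable_fun setT f ->
  (forall x, (0 <= f x)%E) ->
  (\int[P]_w f (xi k w) = \int[P]_w f (xi 0%N w))%E.
Proof.
move=> mf f0.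
rewrite -[LHS]ge0_integral_distribution// -[RHS]ge0_integral_distribution//.
by apply: eq_measure_integral => A mA _; exact: iid.2.
Qed.

Lemma expect_id_distrib k f : bounded_mfun f ->
  \int[P]_w f (xi k w) = \int[P]_w f (xi 0%N w).
Proof.
move=> bf; rewrite /Rintegral.
rewrite (@integral_id_distrib k (EFin \o f))//.
- by apply/measurable_EFinP; case: bf.
- exact: (bounded_mfun_integrable P (bounded_mfun_comp bf (mxi k))).
- exact: (bounded_mfun_integrable P (bounded_mfun_comp bf (mxi 0))).
Qed.

End iid_expectations.

(** * Modulus of the characteristic function of a linear combination *)

Section characteristic_function.
Context {R : realType} {d : measure_display} {T : measurableType d}.
Variables (P : probability T R) (xi : nat -> {RV P >-> R}).
Hypothesis iid : iid_seq xi.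
Implicit Types (c : nat -> R) (s : R) (n : nat).

Let mxi n : measurable_fun setT (xi n : T -> R).
Proof. exact: measurable_funPT. Qed.

Lemma measurable_cos : measurable_fun setT (@cos R).
Proof. by apply: continuous_measurable_fun; exact: continuous_cos. Qed.

Lemma measurable_sin : measurable_fun setT (@sin R).
Proof. by apply: continuous_measurable_fun; exact: continuous_sin. Qed.

Lemma bounded_mfun_cos {d' : measure_display} {U : measurableType d'} (X : U -> R) :
  measurable_fun setT X -> bounded_mfun (fun w => cos (X w)).
Proof.
move=> mX; apply: (bounded_mfun_comp (f := cos)) => //; split; first exact: measurable_cos.
by exists 1 => x; exact: cos_max.
Qed.

Lemma bounded_mfun_sin {d' : measure_display} {U : measurableType d'} (X : U -> R) :
  measurable_fun setT X -> bounded_mfun (fun w => sin (X w)).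
Proof.
move=> mX; apply: (bounded_mfun_comp (f := sin)) => //; split; first exact: measurable_sin.
by exists 1 => x; exact: sin_max.
Qed.

Let mscale s : measurable_fun setT (fun x : R => s * x).
Proof. exact: measurable_funM. Qed.

Let bcos s : bounded_mfun (fun x : R => cos (s * x)).
Proof. exact: bounded_mfun_cos. Qed.

Let bsin s : bounded_mfun (fun x : R => sin (s * x)).
Proof. exact: bounded_mfun_sin. Qed.

(** The squared modulus of a characteristic function is the characteristic function of the
    difference of two independent copies. *)
Lemma charfun_symmetrized s :
  (\int[P]_w cos (s * xi 0%N w)) ^+ 2 + (\int[P]_w sin (s * xi 0%N w)) ^+ 2 =
  \int[P]_w cos (s * (xi 0%N w - xi 1%N w)).
Proof.
have h0 := indep_tail0 iid.
have [hc0 ec0] := indep_tailM h0 (bcos s).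
have [hs0 es0] := indep_tailM h0 (bsin s).
have [[bc _] ec] := indep_tailM hc0 (bcos s).
have [[bs _] es] := indep_tailM hs0 (bsin s).
rewrite expect_cst mul1r in ec0; rewrite expect_cst mul1r in es0.
rewrite ec0 (expect_id_distrib iid 1 (bcos s)) in ec.
rewrite es0 (expect_id_distrib iid 1 (bsin s)) in es.
rewrite !expr2 -ec -es -expect_boundedD//.
by apply: eq_Rintegral => w _; rewrite !mul1r mulrBr cosB.
Qed.

(** Multiplicativity of the squared modulus, written without complex numbers: the addition formulas
    play the role of complex multiplication, and the induction carries independence from the later
    variables. *)
Lemma charfun_sum c n :
  let S w := \sum_(j < n) c j * xi j w in
  [/\ indep_tail xi n (fun w => cos (S w)), indep_tail xi n (fun w => sin (S w)) &
  (\int[P]_w cos (S w)) ^+ 2 + (\int[P]_w sin (S w)) ^+ 2 =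
  \prod_(j < n) \int[P]_w cos (c j * (xi 0%N w - xi 1%N w))].
Proof.
elim: n => [|n [hc hs e]] /=.
  have cE : (fun w : T => cos (\sum_(j < 0) c j * xi j w)) = fun=> 1.
    by apply/funext => w; rewrite big_ord0 cos0.
  have sE : (fun w : T => sin (\sum_(j < 0) c j * xi j w)) = fun=> 0.
    by apply/funext => w; rewrite big_ord0 sin0.
  rewrite cE sE !expect_cst big_ord0 expr1n expr0n addr0; split=> //.
    exact: indep_tail0.
  split; first exact: bounded_mfun_cst.
  move=> m B mB; rewrite expect_cst mul0r.
  by under eq_Rintegral do rewrite mul0r; rewrite expect_cst.
have [hcc ecc] := indep_tailM hc (bcos (c n)).
have [hcs ecs] := indep_tailM hc (bsin (c n)).
have [hsc esc] := indep_tailM hs (bcos (c n)).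
have [hss ess] := indep_tailM hs (bsin (c n)).
have hc' := indep_tailD hcc (indep_tailN hss).
have hs' := indep_tailD hsc hcs.
have cE : (fun w : T => cos (\sum_(j < n.+1) c j * xi j w)) =
    (fun w => cos (\sum_(j < n) c j * xi j w) * cos (c n * xi n w) +
          - (sin (\sum_(j < n) c j * xi j w) * sin (c n * xi n w))).
  by apply/funext => w; rewrite big_ord_recr/= cosD.
have sE : (fun w : T => sin (\sum_(j < n.+1) c j * xi j w)) =
    (fun w => sin (\sum_(j < n) c j * xi j w) * cos (c n * xi n w) +
          cos (\sum_(j < n) c j * xi j w) * sin (c n * xi n w)).
  by apply/funext => w; rewrite big_ord_recr/= sinD.
rewrite cE sE; split=> //.
rewrite big_ord_recr/= -e -charfun_symmetrized.
case: hcc hcs hsc hss => [bcc _] [bcs _] [bsc _] [bss _].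
rewrite expect_boundedD//; last exact: bounded_mfunN.
rewrite expect_boundedD//.
have -> : \int[P]_w (- (sin (\sum_(j < n) c j * xi j w) * sin (c n * xi n w))) =
   - \int[P]_w (sin (\sum_(j < n) c j * xi j w) * sin (c n * xi n w)).
  rewrite -mulN1r -expect_boundedZ//.
  by apply: eq_Rintegral => w _; rewrite mulN1r.
rewrite ecc ecs esc ess (expect_id_distrib iid n (bcos (c n))).
rewrite (expect_id_distrib iid n (bsin (c n))); ring.
Qed.

(** Each factor u of the squared modulus is at most exp(-(1 - u)). In the resulting expectation only
    the event where the difference has size in [[g, M]] is kept; the square root halves the
    exponent. *)
Lemma charfun_bound c n (L p g M : R) : 0 <= L ->
  p <= fine (P [set w | g <= `|xi 0%N w - xi 1%N w| <= M]) ->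
  (forall y, g <= `|y| <= M -> L <= \sum_(j < n) (1 - cos (c j * y))) ->
  \int[P]_w cos (\sum_(j < n) c j * xi j w) <= expR (- (p * L / 2)).
Proof.
move=> L0 pA hL; have [_ _ e] := charfun_sum c n.
set C := \int[P]_w cos _ in e *; set S := \int[P]_w sin _ in e.
have mD : measurable_fun setT (fun w => xi 0%N w - xi 1%N w).
  exact: measurable_funB.
set A := [set w | _] in pA.
have mA : measurable A.
  rewrite (_ : A = [set w | g <= `|xi 0%N w - xi 1%N w|] `&`
                   [set w | `|xi 0%N w - xi 1%N w| <= M]); last first.
    by apply/seteqP; split => w /=; [move=> /andP[]|move=> [h1 h2]; apply/andP].
  have mN : measurable_fun setT (fun w => `|xi 0%N w - xi 1%N w|).
    exact: measurableT_comp.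
  by apply: measurableI; rewrite -[X in measurable X]setTI; exact: measurable_fun_le.
have bc j : bounded_mfun (fun w => cos (c j * (xi 0%N w - xi 1%N w))).
  by apply: bounded_mfun_cos; exact: measurable_funM.
have b1c j : bounded_mfun (fun w => 1 - cos (c j * (xi 0%N w - xi 1%N w))).
  by apply: bounded_mfunD; [exact: bounded_mfun_cst | exact: bounded_mfunN].
have Esum : p * L <= \sum_(j < n) (1 - \int[P]_w cos (c j * (xi 0%N w - xi 1%N w))).
  have -> : \sum_(j < n) (1 - \int[P]_w cos (c j * (xi 0%N w - xi 1%N w))) =
      \int[P]_w \sum_(j < n) (1 - cos (c j * (xi 0%N w - xi 1%N w))).
    rewrite expect_bounded_sum//; apply: eq_bigr => j _.
    rewrite expect_boundedD; [|exact: bounded_mfun_cst|exact: bounded_mfunN].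
    rewrite expect_cst; congr (_ + _); rewrite -mulN1r -expect_boundedZ//.
    by apply: eq_Rintegral => w _; rewrite mulN1r.
  apply: (@le_trans _ _ (\int[P]_w (L * \1_A w))).
    rewrite expect_boundedZ; last exact: bounded_mfun_indic.
    by rewrite expect_indic// mulrC ler_wpM2l.
  apply: expect_bounded_le.
  - by apply: bounded_mfunZ; exact: bounded_mfun_indic.
  - exact: bounded_mfun_sum.
  - move=> w; rewrite indicE; case: (boolP (w \in A)) => [|_].
      by rewrite inE mulr1 => /hL.
    by rewrite mulr0 sumr_ge0// => j _; rewrite subr_ge0 cos_le1.
have CS : C ^+ 2 <= expR (- (p * L)).
  apply: (@le_trans _ _ (C ^+ 2 + S ^+ 2)); first by rewrite lerDl sqr_ge0.
  rewrite e; apply: (@le_trans _ _ (\prod_(j < n)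
      expR (- (1 - \int[P]_w cos (c j * (xi 0%N w - xi 1%N w)))))).
    apply: ler_prod => j _; apply/andP; split.
      by rewrite -charfun_symmetrized addr_ge0 ?sqr_ge0.
    by have := expR_ge1Dx (- (1 - \int[P]_w cos (c j * (xi 0%N w - xi 1%N w)))); lra.
  by rewrite -expR_sum ler_expR sumrN lerN2.
have [C0|C0] := leP C 0; first exact: le_trans C0 (expR_ge0 _).
rewrite -ler_sqr; [|by rewrite nnegrE ltW|by rewrite nnegrE expR_ge0].
apply: le_trans CS _.
by rewrite -expRM_natl ler_expR; lra.
Qed.

End characteristic_function.

(** * Geometric and Gaussian sums, and the Fejer kernel *)

Section kernel_sums.
Context {R : realType}.
Implicit Types (q kap : R) (N : nat).

(** With truncated subtraction the exponent is the distance of [a] and [b]. The factor [1 - q] makes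
    the partial sums on either side of [b] telescope. *)
Lemma sum_geom_dist q b N : 0 <= q <= 1 ->
  (1 - q) * \sum_(a < N) q ^+ ((a - b) + (b - a)) <= 2.
Proof.
move=> /andP[q0 q1].
pose S N := (1 - q) * \sum_(a < N) q ^+ ((a - b) + (b - a)).
have SS m : S m.+1 = S m + (1 - q) * q ^+ ((m - b) + (b - m)).
  by rewrite /S big_ord_recr/= mulrDr.
have left_part m : (m <= b)%N -> S m <= q ^+ (b - m).+1.
  elim: m => [|m ih] mb; first by rewrite /S big_ord0 mulr0 exprn_ge0.
  rewrite SS (eqP (ltnW mb)) add0n (le_trans (lerD (ih (ltnW mb)) (lexx _)))//.
  by rewrite -(subSn mb) subSS exprS -mulrDl addrC subrK mul1r.
have right_part m : S (b + m)%N <= 2 - q ^+ m.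
  elim: m => [|m ih].
    rewrite addn0 expr0 (le_trans (left_part _ (leqnn b)))// subnn expr1; lra.
  rewrite addnS SS addKn -[X in (m + X)%N]subn0 -{2}(addn0 b) subnDl subn0 sub0n addn0.
  by rewrite exprS (le_trans (lerD ih (lexx _)))//; lra.
have [Nb|/ltnW Nb] := leqP N b.
  rewrite -/(S N) (le_trans (left_part _ Nb))//.
  by rewrite (@le_trans _ _ 1) ?exprn_ile1//; lra.
rewrite -/(S N) -(subnKC Nb) (le_trans (right_part _))//.
by have := exprn_ge0 (N - b) q0; lra.
Qed.

(** For integers the squared distance is at least the distance, so the Gaussian is dominated by a
    geometric sequence. *)
Lemma sum_gauss_le kap N : 0 < kap ->
  \sum_(a < N) \sum_(b < N) expR (- (kap * (a%:R - b%:R) ^+ 2)) <=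
  N%:R * (2 / (1 - expR (- kap))).
Proof.
move=> k0; set q := expR (- kap).
have q1 : q < 1 by rewrite -expR0 ltr_expR; lra.
have q0 : 0 <= q by exact: expR_ge0.
rewrite exchange_big/= mulr_natl -[X in _ *+ X]card_ord -sumr_const.
apply: ler_sum => b _; rewrite ler_pdivlMr ?subr_gt0// mulrC.
have q01 : 0 <= q <= 1 by rewrite q0 ltW.
apply: le_trans (sum_geom_dist b N q01).
apply: ler_wpM2l; first by rewrite subr_ge0 ltW.
apply: ler_sum => a _.
rewrite /q -expRM_natl ler_expR mulrN lerN2 [leLHS]mulrC ler_pM2l//.
set m := ((a - b) + (b - a))%N.
have -> : (a%:R - b%:R) ^+ 2 = (m%:R : R) ^+ 2.
  have [ab|/ltnW ab] := leqP a b.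
    by rewrite /m (eqP ab) add0n natrB// -sqrrN opprB.
  by rewrite /m (eqP ab) addn0 natrB.
by rewrite -natrX ler_nat; case: (m) => // l; rewrite expnS expn1 leq_pmulr.
Qed.

Lemma cos_ge_half (x : R) : `|x| <= 1 -> 1 / 2 <= cos x.
Proof.
move=> x1; have := one_minus_cos_le x.
have : `|x| ^+ 2 <= 1 by rewrite expr_le1.
rewrite real_normK ?num_real//; lra.
Qed.

Lemma sum_cos_diff (I : finType) (x : I -> R) :
  \sum_i \sum_j cos (x i - x j) =
  (\sum_i cos (x i)) ^+ 2 + (\sum_i sin (x i)) ^+ 2.
Proof.
rewrite !expr2 !mulr_suml -big_split/=; apply: eq_bigr => i _.
by rewrite !mulr_sumr -big_split/=; apply: eq_bigr => j _; rewrite cosB.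
Qed.

(** The double sum is the squared modulus of an exponential sum. On the square all [N ^ 2] phases
    are at most 1 in absolute value, so the real part of that sum is at least [N ^ 2 / 2]. *)
Lemma kernel_ge (N : nat) (h t u v : R) : 0 <= h -> N%:R * h * t <= 1 / 2 ->
  `|u| <= t -> `|v| <= t ->
  N%:R ^+ 4 / 4 <= \sum_(i : 'I_N * 'I_N) \sum_(j : 'I_N * 'I_N)
    cos (h * (i.1%:R * u + i.2%:R * v) - h * (j.1%:R * u + j.2%:R * v)).
Proof.
move=> h0 Nht ut vt.
rewrite (sum_cos_diff (fun i : 'I_N * 'I_N => h * (i.1%:R * u + i.2%:R * v))).
have part (a : 'I_N) (y : R) : `|y| <= t -> `|h * (a%:R * y)| <= 1 / 2.
  move=> yt; apply: le_trans Nht; rewrite !normrM (ger0_norm h0) normr_nat.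
  rewrite mulrA ler_pM// ?mulr_ge0// mulrC ler_wpM2r// ler_nat.
  exact: ltnW.
have h1 : N%:R ^+ 2 / 2 <= \sum_(i : 'I_N * 'I_N) cos (h * (i.1%:R * u + i.2%:R * v)).
  have -> : N%:R ^+ 2 / 2 = \sum_(i : 'I_N * 'I_N) (1 / 2 : R).
    by rewrite sumr_const card_prod card_ord -[RHS]mulr_natl natrM; ring.
  apply: ler_sum => i _; apply: cos_ge_half.
  rewrite mulrDr (le_trans (ler_normD _ _))//.
  by have := part i.1 u ut; have := part i.2 v vt; lra.
have : (N%:R ^+ 2 / 2) ^+ 2 <= (\sum_(i : 'I_N * 'I_N) cos (h * (i.1%:R * u + i.2%:R * v))) ^+ 2.
  by rewrite ler_pXn2r// nnegrE ?(le_trans _ h1)// divr_ge0// exprn_ge0.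
have := sqr_ge0 (\sum_(i : 'I_N * 'I_N) sin (h * (i.1%:R * u + i.2%:R * v))).
have -> : (N%:R ^+ 2 / 2) ^+ 2 = N%:R ^+ 4 / 4 :> R by field.
lra.
Qed.

End kernel_sums.

(** * Small-ball probabilities bounded by characteristic functions *)

Section small_ball.
Context {R : realType} {d : measure_display} {T : measurableType d}.
Variables (P : probability T R) (xi : nat -> {RV P >-> R}).
Hypothesis iid : iid_seq xi.
Implicit Types (n k N : nat) (t h : R).

Let mxi n : measurable_fun setT (xi n : T -> R).
Proof. exact: measurable_funPT. Qed.

Lemma measurable_dft_re n k :
  measurable_fun setT (fun w => dft_re n k (fun j => xi j w)).
Proof. by apply: measurable_sum => j; exact: measurable_funM. Qed.

Lemma measurable_dft_im n k :
  measurable_fun setT (fun w => dft_im n k (fun j => xi j w)).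
Proof. by apply: measurable_sum => j; exact: measurable_funM. Qed.

(** A square rather than a disc, to match the product grid of the kernel; it contains the disc of
    radius [t]. *)
Definition small_dft n k t : set T :=
  [set w | `|dft_re n k (fun j => xi j w)| <= t] `&`
  [set w | `|dft_im n k (fun j => xi j w)| <= t].

Lemma measurable_small_dft n k t : measurable (small_dft n k t).
Proof.
apply: measurableI; rewrite -[X in measurable X]setTI; apply: measurable_fun_le => //.
  by apply: measurableT_comp => //; exact: measurable_dft_re.
by apply: measurableT_comp => //; exact: measurable_dft_im.
Qed.

(** The kernel is nonnegative everywhere and at least [N ^ 4 / 4] on the event, so its multiple by
    [4 / N ^ 4] dominates the indicator. *)
Lemma small_dft_kernel n k N t h : (0 < N)%N -> 0 <= h ->
  N%:R * h * t <= 1 / 2 ->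
  fine (P (small_dft n k t)) <= 4 / N%:R ^+ 4 *
  \sum_(i : 'I_N * 'I_N) \sum_(j : 'I_N * 'I_N)
    \int[P]_w cos (\sum_(l < n) trig_form n k
      (h * (i.1%:R - j.1%:R)) (h * (i.2%:R - j.2%:R)) l * xi l w).
Proof.
move=> N0 h0 Nht.
have N4 : 0 < N%:R ^+ 4 :> R by rewrite exprn_gt0// ltr0n.
have bc (i j : 'I_N * 'I_N) : bounded_mfun (fun w => cos (\sum_(l < n) trig_form n k
      (h * (i.1%:R - j.1%:R)) (h * (i.2%:R - j.2%:R)) l * xi l w)).
  apply: bounded_mfun_cos; apply: measurable_sum => l; exact: measurable_funM.
have bcc (i : 'I_N * 'I_N) : bounded_mfun (fun w => \sum_(j : 'I_N * 'I_N)
    cos (\sum_(l < n) trig_form n k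
      (h * (i.1%:R - j.1%:R)) (h * (i.2%:R - j.2%:R)) l * xi l w)).
  by apply: bounded_mfun_sum => j; exact: bc.
under eq_bigr do rewrite -expect_bounded_sum//.
rewrite -expect_bounded_sum// -expect_boundedZ; last exact: bounded_mfun_sum.
rewrite -expect_indic; last exact: measurable_small_dft.
apply: expect_bounded_le.
- exact/bounded_mfun_indic/measurable_small_dft.
- exact/bounded_mfunZ/bounded_mfun_sum.
move=> w; set u := dft_re n k (fun j => xi j w); set v := dft_im n k (fun j => xi j w).
have -> : \sum_(i : 'I_N * 'I_N) \sum_(j : 'I_N * 'I_N)
    cos (\sum_(l < n) trig_form n k
      (h * (i.1%:R - j.1%:R)) (h * (i.2%:R - j.2%:R)) l * xi l w) =
  \sum_(i : 'I_N * 'I_N) \sum_(j : 'I_N * 'I_N)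
    cos (h * (i.1%:R * u + i.2%:R * v) - h * (j.1%:R * u + j.2%:R * v)).
  apply: eq_bigr => i _; apply: eq_bigr => j _; congr cos.
  transitivity (h * (i.1%:R - j.1%:R) * u + h * (i.2%:R - j.2%:R) * v); last by ring.
  rewrite /u /v /dft_re /dft_im !mulr_sumr -big_split/=; apply: eq_bigr => l _.
  by rewrite /trig_form; ring.
rewrite indicE; case: (boolP (w \in _)) => [|_].
  rewrite inE => -[/= hu hv]; have := kernel_ge h0 Nht hu hv.
  rewrite -(ler_pM2l (_ : 0 < 4 / N%:R ^+ 4)) ?divr_gt0//; apply: le_trans.
  by rewrite le_eqVlt; apply/orP; left; apply/eqP; field; rewrite gt_eqF// ltr0n.
rewrite (sum_cos_diff (fun i : 'I_N * 'I_N => h * (i.1%:R * u + i.2%:R * v))).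
by rewrite mulr_ge0 ?divr_ge0 ?addr_ge0 ?sqr_ge0// ltW.
Qed.

End small_ball.

(** * Separation of two independent copies under condition (H) *)

Section separation.
Context {R : realType} {d : measure_display} {T : measurableType d}.
Variables (P : probability T R) (xi : nat -> {RV P >-> R}).
Hypothesis iid : iid_seq xi.

Let mxi n : measurable_fun setT (xi n : T -> R).
Proof. exact: measurable_funPT. Qed.

Let m_dist_le (u a : R) : measurable [set x : R | `|x - u| <= a].
Proof.
rewrite -[X in measurable X]setTI; apply: measurable_fun_le => //.
by apply: measurableT_comp => //; exact: measurable_funB.
Qed.

(** Countably many intervals of radius 1/2, centred at the half-integers, cover the line, so they
    cannot all be null. *)
Lemma exists_charged_interval :
  exists u : R, (0 < P [set w | (`|xi 0%N w - u| <= 1 / 2)%R])%E.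
Proof.
apply: contrapT => h.
have P0 u : P [set w | `|xi 0%N w - u| <= 1 / 2] = 0%E.
  apply/eqP; rewrite eq_le measure_ge0 andbT leNgt; apply/negP => u0.
  by apply: h; exists u.
pose F k := [set w | `|xi 0%N w - k%:R / 2| <= 1 / 2] `|`
            [set w | `|xi 0%N w - (- (k%:R / 2))| <= 1 / 2].
have mF u : measurable [set w | `|xi 0%N w - u| <= 1 / 2].
  exact: (measurable_funPTI (xi 0%N) (m_dist_le u (1 / 2))).
have negF : P.-negligible (\bigcup_k F k).
  apply: negligible_bigcup => k; apply: negligibleU; apply/negligibleP => //;
  exact: P0.
have : P.-negligible [set: T].
  apply: negligibleS negF => w _.
  exists (Num.truncn (2 * `|xi 0%N w|)) => //.
  have /truncn_itv/andP : 0 <= 2 * `|xi 0%N w| by rewrite mulr_ge0.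
  set k := Num.truncn _ => -[k1 k2]; rewrite -natr1 in k2.
  have [x0|x0] := leP 0 (xi 0%N w).
    by left => /=; rewrite ger0_norm// in k1 k2; rewrite ler_norml; lra.
  by right => /=; rewrite ltr0_norm// in k1 k2; rewrite ler_norml; lra.
move=> /negligibleP -/(_ measurableT) /eqP.
by rewrite [X in X == _](probability_setT P) onee_eq0.
Qed.

(** Take [xi 0] within 1/2 of a charged centre [u], and [xi 1] farther than 1 from [u] but bounded
    by [M]. By (H) the second event has probability at least q - q/2. *)
Lemma separated_pair : condH (xi 0%N) -> exists p M : R,
  [/\ 0 < p, 1 <= M &
      p <= fine (P [set w | 1 / 2 <= `|xi 0%N w - xi 1%N w| <= M])].
Proof.
move=> [M [q [M0 [/andP[q0 q1] [hq hM]]]]].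
have [u u0] := exists_charged_interval.
pose I := [set x : R | `|x - u| <= 1 / 2].
pose J := [set x : R | `|x - u| <= 1] `|` [set x : R | M < `|x|].
have mI : measurable I by exact: m_dist_le.
have mM : measurable [set x : R | M < `|x|].
  rewrite (_ : [set _ | _] = ~` [set x : R | `|x - 0| <= M]).
    by apply: measurableC; exact: m_dist_le.
  apply/seteqP; split => x /=; rewrite subr0; last by move=> /negP; rewrite -ltNge.
  by move=> h; apply/negP; rewrite -ltNge.
have mJ : measurable J by apply: measurableU => //; exact: m_dist_le.
have mxJ k (B : set R) : measurable B -> measurable (xi k @^-1` B).
  by move=> mB; exact: measurable_funPTI.
have PJ : (P (xi 0%N @^-1` J) <= (1 - q / 2)%:E)%E.
  rewrite preimage_setU (le_trans (measureU2 _ _ _))//; [by apply: mxJ; exact: m_dist_le|exact: mxJ|].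
  have -> : (1 - q / 2)%:E = ((1 - q)%:E + (q / 2)%:E)%E by rewrite -EFinD; congr EFin; lra.
  by apply: leeD; [exact: hq|exact: hM].
have PJC : ((q / 2)%:E <= P (xi 0%N @^-1` (~` J)))%E.
  rewrite -preimage_setC probability_setC; last exact: mxJ.
  move: PJ; rewrite -(fineK (fin_num_measure P _ (mxJ 0%N _ mJ))) -EFinB !lee_fin; lra.
pose B i := if i is 0%N then I else ~` J.
have mB i : measurable (B i) by case: i => //= _; exact: measurableC.
have := iid.1 2%N B mB.
rewrite !big_ord_recr !big_ord0/= setTI mul1e.
rewrite [X in (_ * X)%E](_ : _ = P (xi 0%N @^-1` (~` J))); last first.
  by apply: iid.2; exact: measurableC.
set A := _ `&` _ => PA.
have mA : measurable A by apply: measurableI; apply: mxJ => //; exact: measurableC.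
have finA := fin_num_measure P _ mA.
have finI := fin_num_measure P _ (mxJ 0%N _ mI).
have finJ := fin_num_measure P _ (mxJ 0%N _ (measurableC mJ)).
(* The final [1] secures [1 <= M']. *)
pose M' := `|u| + 1 / 2 + M + 1.
exists (fine (P A)), M'; split.
- rewrite PA fineM// mulr_gt0//.
    by rewrite fine_gt0//; apply/andP; split => //; rewrite ltey_eq finI.
  rewrite (lt_le_trans _ (_ : q / 2 <= _)) ?divr_gt0//.
  by rewrite -lee_fin fineK.
- by have := normr_ge0 u; rewrite /M'; lra.
have mD : measurable_fun setT (fun w => `|xi 0%N w - xi 1%N w|).
  by apply: measurableT_comp => //; exact: measurable_funB.
have mE : measurable [set w | 1 / 2 <= `|xi 0%N w - xi 1%N w| <= M'].
  rewrite (_ : [set w | _] = [set w | 1 / 2 <= `|xi 0%N w - xi 1%N w|] `&`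
                   [set w | `|xi 0%N w - xi 1%N w| <= M']); last first.
    by apply/seteqP; split => w /=; [move=> /andP[]|move=> [h1 h2]; apply/andP].
  by apply: measurableI; rewrite -[X in measurable X]setTI; exact: measurable_fun_le.
rewrite fine_le//; first exact: fin_num_measure.
apply: le_measure; rewrite ?inE//.
move=> w [/= h0 /not_orP[/negP + /negP]]; rewrite -ltNge -leNgt => h1 h2.
rewrite /I/= in h0.
have e1 : xi 1%N w - u = (xi 1%N w - xi 0%N w) + (xi 0%N w - u) by ring.
have e2 : xi 0%N w - xi 1%N w = (xi 0%N w - u) + (u - xi 1%N w) by ring.
apply/andP; split.
  have := ler_normD (xi 1%N w - xi 0%N w) (xi 0%N w - u).
  by rewrite -e1 (distrC (xi 1%N w) (xi 0%N w)); lra.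
rewrite e2 /M'; have := ler_normD (xi 0%N w - u) (u - xi 1%N w).
by have := ler_normB u (xi 1%N w); lra.
Qed.

End separation.

(** * Small-ball bounds for a single frequency *)

Section small_ball_bounds.
Context {R : realType} {d : measure_display} {T : measurableType d}.
Variables (P : probability T R) (xi : nat -> {RV P >-> R}) (p M : R).
Hypothesis iid : iid_seq xi.
Hypothesis p_gt0 : 0 < p.
Hypothesis M_ge1 : 1 <= M.
Hypothesis sep : p <= fine (P [set w | 1 / 2 <= `|xi 0%N w - xi 1%N w| <= M]).
Implicit Types (n k N : nat) (t : R).

(** In the unsaturated case the exponent [p * L / 2] equals [kap * D], where [L] is [n / 256] times
    [D / (4 * n)]. [C] is the constant of the Gaussian sum. *)
Let kap : R := p / 8 / 256.
Let C : R := 2 / (1 - expR (- kap)).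

Let kap_gt0 : 0 < kap. Proof. by rewrite !divr_gt0 ?p_gt0 ?ltr0n. Qed.

Let C_gt0 : 0 < C.
Proof. by rewrite divr_gt0// subr_gt0 -expR0 ltr_expR oppr_lt0. Qed.

Let trig_form_scale n k (a b y : R) j :
  trig_form n k a b j * y = trig_form n k (a * y) (b * y) j.
Proof. by rewrite /trig_form; ring. Qed.

Let dist_sqr_le N (a b : 'I_N) : (a%:R - b%:R) ^+ 2 <= N%:R ^+ 2 :> R.
Proof.
rewrite -[leLHS]real_normK ?num_real// ler_pXn2r ?nnegrE// ler_norml.
have aN : a%:R <= N%:R :> R by rewrite ler_nat ltnW.
have bN : b%:R <= N%:R :> R by rewrite ler_nat ltnW.
have a0 : 0 <= a%:R :> R by []. have b0 : 0 <= b%:R :> R by [].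
by apply/andP; split; lra.
Qed.

Let sqr_bounds (y : R) : 1 / 2 <= `|y| <= M -> 1 / 4 <= y ^+ 2 <= M ^+ 2.
Proof.
move=> /andP[y1 y2]; rewrite -[y ^+ 2]real_normK ?num_real//.
by apply/andP; split; [|rewrite ler_pXn2r ?nnegrE// (le_trans _ M_ge1)]; nra.
Qed.

(** With mesh 1 / sqrt n, either alternative brings all grid differences within reach of the lower
    bound on the cosine sum. Saturated differences cost the exponential term; the others give a
    Gaussian sum that factors over the two coordinates, (N C)^2 out of N^4. *)
Lemma small_dft_complex n k N t : (0 < n)%N -> ~~ (n %| k.*2)%N -> (0 < N)%N ->
  N%:R / Num.sqrt n%:R * t <= 1 / 2 ->
  2 * (M ^+ 2 * N%:R ^+ 2) <= n%:R \/
  128 * (M ^+ 2 * N%:R ^+ 2) * (gcdn k n)%:R ^+ 2 <= n%:R ^+ 3 ->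
  fine (P (small_dft xi n k t)) <=
  4 * expR (- (p * n%:R / 512)) + 4 * C ^+ 2 / N%:R ^+ 2.
Proof.
move=> n0 nk N0 Nht cond.
have nR : 0 < n%:R :> R by rewrite ltr0n.
have NR : 0 < N%:R :> R by rewrite ltr0n.
set h := (Num.sqrt n%:R)^-1 in Nht.
have h0 : 0 <= h by rewrite invr_ge0 sqrtr_ge0.
have h2 : h ^+ 2 = n%:R^-1 by rewrite exprVn sqr_sqrtr.
apply: le_trans (small_dft_kernel xi n k N0 h0 Nht) _.
have term (i j : 'I_N * 'I_N) :
   \int[P]_w cos (\sum_(l < n) trig_form n k
      (h * (i.1%:R - j.1%:R)) (h * (i.2%:R - j.2%:R)) l * xi l w) <=
   expR (- (p * n%:R / 512)) +
   expR (- (kap * (i.1%:R - j.1%:R) ^+ 2)) * expR (- (kap * (i.2%:R - j.2%:R) ^+ 2)).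
  set D := ((i.1%:R - j.1%:R) ^+ 2 + (i.2%:R - j.2%:R) ^+ 2 : R).
  have D0 : 0 <= D by rewrite addr_ge0 ?sqr_ge0.
  have DN : D <= 2 * N%:R ^+ 2.
    by have := dist_sqr_le i.1 j.1; have := dist_sqr_le i.2 j.2; rewrite /D; lra.
  (* The 4 comes from [y ^ 2 >= 1 / 4] on the separation event. *)
  pose L := n%:R / 256 * Num.min 1 (D / (4 * n%:R)).
  have L0 : 0 <= L.
    by rewrite mulr_ge0 ?divr_ge0 ?ler0n// le_min ler01/= divr_ge0// mulr_ge0.
  apply: (@le_trans _ _ (expR (- (p * L / 2)))).
    apply: (charfun_bound iid L0 sep) => y /sqr_bounds /andP[y1 y2].
    under eq_bigr do rewrite trig_form_scale.
    set a := h * (i.1%:R - j.1%:R) * y; set b := h * (i.2%:R - j.2%:R) * y.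
    have ab : a ^+ 2 + b ^+ 2 = D * y ^+ 2 / n%:R.
      by rewrite /a /b !exprMn h2 /D; ring.
    have abM : a ^+ 2 + b ^+ 2 <= 2 * (M ^+ 2 * N%:R ^+ 2) / n%:R.
      rewrite ab ler_pM2r ?invr_gt0//.
      apply: (@le_trans _ _ (2 * N%:R ^+ 2 * M ^+ 2)); last by lra.
      by rewrite ler_pM// sqr_ge0.
    apply: le_trans (sum_one_minus_cos_ge n0 nk _); last first.
      case: cond => cond; [left|right].
        by rewrite (le_trans abM)// ler_pdivrMr// mul1r.
      apply: (@le_trans _ _ (64 * (2 * (M ^+ 2 * N%:R ^+ 2) / n%:R) * (gcdn k n)%:R ^+ 2)).
        by rewrite ler_wpM2r ?sqr_ge0// ler_pM2l.
      have -> : 64 * (2 * (M ^+ 2 * N%:R ^+ 2) / n%:R) * (gcdn k n)%:R ^+ 2 =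
        128 * (M ^+ 2 * N%:R ^+ 2) * (gcdn k n)%:R ^+ 2 / n%:R :> R by field; rewrite gt_eqF.
      by rewrite ler_pdivrMr// -exprSr.
    rewrite /L ler_wpM2l ?divr_ge0 ?ler0n// le_min; apply/andP; split.
      by rewrite ge_min lexx.
    rewrite ge_min; apply/orP; right; rewrite ab invfM mulrA ler_pM2r ?invr_gt0//.
    by rewrite ler_wpM2l//; lra.
  rewrite /L -expRD; have [m1|m1] := leP 1 (D / (4 * n%:R)).
    apply: (@le_trans _ _ (expR (- (p * n%:R / 512)))); last first.
      by rewrite lerDl expR_ge0.
    by rewrite ler_expR; lra.
  rewrite [X in expR X <= _](_ : _ = - (kap * (i.1%:R - j.1%:R) ^+ 2)
    + - (kap * (i.2%:R - j.2%:R) ^+ 2)); first by rewrite lerDr expR_ge0.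
  by rewrite /kap /D; field; rewrite gt_eqF.
have step1 : \sum_(i : 'I_N * 'I_N) \sum_(j : 'I_N * 'I_N)
    \int[P]_w cos (\sum_(l < n) trig_form n k
      (h * (i.1%:R - j.1%:R)) (h * (i.2%:R - j.2%:R)) l * xi l w) <=
  N%:R ^+ 4 * expR (- (p * n%:R / 512)) + (N%:R * C) ^+ 2.
  apply: (@le_trans _ _ (\sum_(i : 'I_N * 'I_N) \sum_(j : 'I_N * 'I_N)
    (expR (- (p * n%:R / 512)) +
   expR (- (kap * (i.1%:R - j.1%:R) ^+ 2)) * expR (- (kap * (i.2%:R - j.2%:R) ^+ 2))))).
    by apply: ler_sum => i _; apply: ler_sum => j _; exact: term.
  under eq_bigr do rewrite big_split/=.
  rewrite big_split/=; apply: lerD.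
    rewrite !sumr_const !card_prod !card_ord -!mulrnA -[leLHS]mulr_natl.
    by rewrite !natrM le_eqVlt; apply/orP; left; apply/eqP; ring.
  set G := \sum_(a < N) \sum_(b < N) expR (- (kap * (a%:R - b%:R) ^+ 2)).
  have GE : \sum_(i : 'I_N * 'I_N) \sum_(j : 'I_N * 'I_N)
     expR (- (kap * (i.1%:R - j.1%:R) ^+ 2)) * expR (- (kap * (i.2%:R - j.2%:R) ^+ 2))
     = G ^+ 2.
    transitivity (\sum_(i : 'I_N * 'I_N)
       ((\sum_(b < N) expR (- (kap * (i.1%:R - b%:R) ^+ 2))) *
        (\sum_(b < N) expR (- (kap * (i.2%:R - b%:R) ^+ 2))))).
      apply: eq_bigr => i _; rewrite big_distrlr/= pair_big/=.
      by apply: eq_bigr => -[].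
    rewrite expr2 /G big_distrlr/= pair_big/=.
    by apply: eq_bigr => -[].
  rewrite GE; have G0 : 0 <= G.
    by apply: sumr_ge0 => a _; apply: sumr_ge0 => b _; exact: expR_ge0.
  rewrite ler_pXn2r ?nnegrE//; last by rewrite mulr_ge0// ltW.
  exact: sum_gauss_le.
apply: le_trans (ler_wpM2l _ step1) _; first by rewrite divr_ge0// exprn_ge0.
rewrite le_eqVlt; apply/orP; left; apply/eqP; field.
by rewrite gt_eqF.
Qed.

(** Only the first grid coordinate produces decay, so the saving is a factor [N] instead of
    [N ^ 2]. *)
Lemma small_dft_real n k N t : (0 < n)%N -> (n %| k.*2)%N -> (0 < N)%N ->
  N%:R / Num.sqrt n%:R * t <= 1 / 2 -> M ^+ 2 * N%:R ^+ 2 <= n%:R ->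
  fine (P (small_dft xi n k t)) <= 4 * C / N%:R.
Proof.
move=> n0 nk N0 Nht cond.
have nR : 0 < n%:R :> R by rewrite ltr0n.
have NR : 0 < N%:R :> R by rewrite ltr0n.
set h := (Num.sqrt n%:R)^-1 in Nht.
have h0 : 0 <= h by rewrite invr_ge0 sqrtr_ge0.
have h2 : h ^+ 2 = n%:R^-1 by rewrite exprVn sqr_sqrtr.
apply: le_trans (small_dft_kernel xi n k N0 h0 Nht) _.
have term (i j : 'I_N * 'I_N) :
   \int[P]_w cos (\sum_(l < n) trig_form n k
      (h * (i.1%:R - j.1%:R)) (h * (i.2%:R - j.2%:R)) l * xi l w) <=
   expR (- (kap * (i.1%:R - j.1%:R) ^+ 2)).
  set D := ((i.1%:R - j.1%:R) ^+ 2 : R).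
  have D0 : 0 <= D by exact: sqr_ge0.
  have DN : D <= N%:R ^+ 2 by exact: dist_sqr_le.
  pose L := n%:R / 256 * (D / (4 * n%:R)).
  have h4n : 0 <= 4 * n%:R :> R by rewrite mulr_ge0.
  have L0 : 0 <= L by rewrite mulr_ge0 ?(divr_ge0 D0 h4n) ?divr_ge0 ?ler0n.
  apply: (@le_trans _ _ (expR (- (p * L / 2)))).
    apply: (charfun_bound iid L0 sep) => y /sqr_bounds /andP[y1 y2].
    under eq_bigr do rewrite trig_form_scale.
    set a := h * (i.1%:R - j.1%:R) * y.
    have aE : a ^+ 2 = D * y ^+ 2 / n%:R.
      by rewrite /a !exprMn h2 /D; ring.
    apply: le_trans (sum_one_minus_cos_real _ n0 nk _); last first.
      rewrite aE ler_pdivrMr// mul1r; apply: le_trans cond.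
      by rewrite mulrC ler_pM// sqr_ge0.
    rewrite /L ler_wpM2l ?divr_ge0 ?ler0n// aE invfM mulrA ler_pM2r ?invr_gt0//.
    by rewrite ler_wpM2l//; lra.
  rewrite ler_expR le_eqVlt; apply/orP; left; apply/eqP.
  by rewrite /kap /L; field; rewrite gt_eqF.
have step1 : \sum_(i : 'I_N * 'I_N) \sum_(j : 'I_N * 'I_N)
    \int[P]_w cos (\sum_(l < n) trig_form n k
      (h * (i.1%:R - j.1%:R)) (h * (i.2%:R - j.2%:R)) l * xi l w) <=
  N%:R ^+ 2 * (N%:R * C).
  apply: (@le_trans _ _ (\sum_(i : 'I_N * 'I_N) \sum_(j : 'I_N * 'I_N)
     expR (- (kap * (i.1%:R - j.1%:R) ^+ 2)))).
    by apply: ler_sum => i _; apply: ler_sum => j _; exact: term.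
  set G := \sum_(a < N) \sum_(b < N) expR (- (kap * (a%:R - b%:R) ^+ 2)).
  have -> : \sum_(i : 'I_N * 'I_N) \sum_(j : 'I_N * 'I_N)
     expR (- (kap * (i.1%:R - j.1%:R) ^+ 2)) = N%:R ^+ 2 * G.
    transitivity (\sum_(i : 'I_N * 'I_N)
       (N%:R * \sum_(b < N) expR (- (kap * (i.1%:R - b%:R) ^+ 2)))).
      apply: eq_bigr => i _.
      rewrite -(pair_bigA _ (fun a b : 'I_N => expR (- (kap * (i.1%:R - a%:R) ^+ 2))))/=.
      by rewrite mulr_sumr; apply: eq_bigr => a _; rewrite sumr_const card_ord mulr_natl.
    rewrite -(pair_bigA _ (fun a b : 'I_N => N%:R * \sum_(b0 < N) expR (- (kap * (a%:R - b0%:R) ^+ 2))))/=.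
    rewrite /G mulr_sumr; apply: eq_bigr => a _; rewrite sumr_const card_ord -[LHS]mulr_natl.
    by rewrite mulrA expr2.
  by rewrite ler_wpM2l ?sqr_ge0//; exact: sum_gauss_le.
apply: le_trans (ler_wpM2l _ step1) _; first by rewrite divr_ge0// exprn_ge0.
rewrite le_eqVlt; apply/orP; left; apply/eqP; field.
by rewrite gt_eqF.
Qed.

Lemma exists_scale (r s : R) : 0 < s -> 2 * s <= r ->
  exists2 N, (0 < N)%N & r / (4 * s) <= N%:R <= r / (2 * s).
Proof.
move=> s0 sr; have -> : r / (4 * s) = r / (2 * s) / 2 by field; rewrite gt_eqF.
have : 1 <= r / (2 * s) by rewrite ler_pdivlMr ?mulr_gt0// mul1r.
move: (r / (2 * s)) => x x1.
have /truncn_itv/andP[l1 l2] : 0 <= x by rewrite (le_trans _ x1).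
exists (Num.truncn x); first by rewrite truncn_gt0.
rewrite l1 andbT; rewrite -natr1 in l2.
have : 1 <= (Num.truncn x)%:R :> R by rewrite ler1n truncn_gt0.
by move: l2; move: (_%:R) => y; lra.
Qed.

Let E : R := 4 * (512 / p) ^+ 2.

Let E_gt0 : 0 < E.
Proof. by rewrite /E mulr_gt0 ?exprn_gt0 ?divr_gt0 ?p_gt0 ?ltr0n. Qed.

Lemma expR_linear_le n : (0 < n)%N ->
  expR (- (p * n%:R / 512)) <= E / n%:R ^+ 2.
Proof.
move=> n0; have nR : 0 < n%:R :> R by rewrite ltr0n.
set x := p * n%:R / 512.
have x0 : 0 < x by rewrite /x divr_gt0 ?mulr_gt0 ?ltr0n.
have -> : E / n%:R ^+ 2 = ((x / 2) ^+ 2)^-1.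
  by rewrite /E /x; field; rewrite !gt_eqF.
rewrite expRN lef_pV2 ?posrE ?expR_gt0//; last by rewrite exprn_gt0// divr_gt0.
by apply: sqr_half_le_expR; exact: ltW.
Qed.

(** The first two bounds take [N] of order sqrt n / M, whatever [t] is. The third takes [N] of order
    sqrt n / t, which is admissible once the order of the frequency is at least 6 M / t. *)
Lemma small_dft_bounds n k t : (0 < n)%N -> 0 < t <= 1 ->
  2 * M <= Num.sqrt n%:R ->
  [/\ (n %| k.*2)%N -> fine (P (small_dft xi n k t)) <= 16 * C * M / Num.sqrt n%:R,
      ~~ (n %| k.*2)%N -> fine (P (small_dft xi n k t)) <=
        (4 * E + 64 * C ^+ 2 * M ^+ 2) / n%:R &
      ~~ (n %| k.*2)%N -> 6 * M * (gcdn k n)%:R <= n%:R * t ->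
        fine (P (small_dft xi n k t)) <=
        4 * E / n%:R ^+ 2 + 64 * C ^+ 2 * t ^+ 2 / n%:R].
Proof.
move=> n0 /andP[t0 t1] nM.
have n1 : 1 <= n%:R :> R by rewrite ler1n.
have M0 : 0 < M by rewrite (lt_le_trans _ M_ge1).
set r := Num.sqrt n%:R in nM *.
have r0 : 0 < r by rewrite (lt_le_trans _ nM)// mulr_gt0.
have r2 : r ^+ 2 = n%:R by rewrite sqr_sqrtr.
have inv_sqr (s : R) (N : nat) : 0 < s -> (0 < N)%N -> r / (4 * s) <= N%:R ->
    4 * C ^+ 2 / N%:R ^+ 2 <= 64 * C ^+ 2 * s ^+ 2 / n%:R.
  move=> s0 N0 rN; have NR : 0 < N%:R :> R by rewrite ltr0n.
  rewrite ler_pdivrMr ?exprn_gt0// -r2.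
  have : r ^+ 2 <= 16 * s ^+ 2 * N%:R ^+ 2.
    have -> : 16 * s ^+ 2 * N%:R ^+ 2 = (4 * s * N%:R) ^+ 2 by ring.
    rewrite ler_pXn2r ?nnegrE ?mulr_ge0 ?(ltW r0) ?(ltW s0)//.
    by rewrite mulrC -ler_pdivrMr ?mulr_gt0.
  move=> h; rewrite mulrAC ler_pdivlMr ?exprn_gt0//.
  have -> : 64 * C ^+ 2 * s ^+ 2 * N%:R ^+ 2 =
    4 * C ^+ 2 * (16 * s ^+ 2 * N%:R ^+ 2) by ring.
  by rewrite ler_wpM2l// mulr_ge0// sqr_ge0.
have [N N0 /andP[N1 N2]] := exists_scale M0 nM.
have NR : 0 < N%:R :> R by rewrite ltr0n.
have MN : 2 * (M * N%:R) <= r by rewrite mulrA mulrC -ler_pdivlMr ?mulr_gt0.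
have MN2 : 4 * (M ^+ 2 * N%:R ^+ 2) <= n%:R.
  have -> : 4 * (M ^+ 2 * N%:R ^+ 2) = (2 * (M * N%:R)) ^+ 2 by ring.
  by rewrite -r2 ler_pXn2r ?nnegrE ?mulr_ge0 ?(ltW r0) ?(ltW M0).
have MN0 : 0 <= M ^+ 2 * N%:R ^+ 2 by rewrite mulr_ge0 ?sqr_ge0.
have Nt : N%:R / r * t <= 1 / 2.
  apply: (@le_trans _ _ (N%:R / r)); first by rewrite ler_piMr// divr_ge0// ltW.
  rewrite ler_pdivrMr//; have : N%:R <= M * N%:R by rewrite ler_peMl// ltW.
  lra.
have e4 : 4 * expR (- (p * n%:R / 512)) <= 4 * E / n%:R ^+ 2.
  by rewrite -[leRHS]mulrA ler_pM2l// expR_linear_le.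
split=> [nk|nk|nk gk].
- apply: le_trans (small_dft_real n0 nk N0 Nt _) _; first lra.
  rewrite ler_pdivrMr// mulrAC ler_pdivlMr//.
  have : r <= 4 * M * N%:R by rewrite mulrC -ler_pdivrMr ?mulr_gt0.
  move=> h; have : 4 * C * r <= 4 * C * (4 * M * N%:R) by rewrite ler_wpM2l// mulr_ge0// ltW.
  lra.
- apply: le_trans (small_dft_complex n0 nk N0 Nt _) _; first by left; lra.
  rewrite [leRHS]mulrDl; apply: lerD; last exact: inv_sqr.
  apply: le_trans e4 _.
  apply: ler_wpM2l; first by rewrite mulr_ge0 ?(ltW E_gt0).
  by rewrite lef_pV2 ?posrE ?exprn_gt0 ?ltr0n// expr2 ler_peMl.
- have [|L L0 /andP[L1 L2]] := @exists_scale r t t0; first by have := M_ge1; lra.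
  have Lt : 2 * (L%:R * t) <= r.
    by rewrite mulrCA -ler_pdivlMr ?mulr_gt0.
  apply: le_trans (small_dft_complex n0 nk L0 _ _) _.
  + by rewrite -/r mulrAC ler_pdivrMr//; move: Lt; lra.
  + right; have g0 : 0 <= (gcdn k n)%:R :> R by [].
    have h1 : 4 * (L%:R ^+ 2 * t ^+ 2) <= n%:R.
      have -> : 4 * (L%:R ^+ 2 * t ^+ 2) = (2 * (L%:R * t)) ^+ 2 by ring.
      by rewrite -r2 ler_pXn2r ?nnegrE ?mulr_ge0 ?(ltW r0) ?(ltW t0).
    have h2 : 36 * (M ^+ 2 * (gcdn k n)%:R ^+ 2) <= n%:R ^+ 2 * t ^+ 2.
      have -> : 36 * (M ^+ 2 * (gcdn k n)%:R ^+ 2) = (6 * M * (gcdn k n)%:R) ^+ 2 by ring.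
      by rewrite -exprMn ler_pXn2r ?nnegrE ?mulr_ge0 ?(ltW M0) ?(ltW t0).
    rewrite -(ler_pM2r (exprn_gt0 2 t0)).
    (* The product 4 * 36 = 144 covers the required constant 128. *)
    have h3 : 4 * (L%:R ^+ 2 * t ^+ 2) * (36 * (M ^+ 2 * (gcdn k n)%:R ^+ 2)) <=
        n%:R * (n%:R ^+ 2 * t ^+ 2).
      have ha : 0 <= L%:R ^+ 2 * t ^+ 2 by apply: mulr_ge0; exact: sqr_ge0.
      have hb : 0 <= M ^+ 2 * (gcdn k n)%:R ^+ 2 by apply: mulr_ge0; exact: sqr_ge0.
      by apply: ler_pM h1 h2; apply: mulr_ge0; rewrite ?ler0n.
    have h4 : 0 <= L%:R ^+ 2 * t ^+ 2 * (M ^+ 2 * (gcdn k n)%:R ^+ 2).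
      by apply: mulr_ge0; apply: mulr_ge0; exact: sqr_ge0.
    have -> : n%:R ^+ 3 * t ^+ 2 = n%:R * (n%:R ^+ 2 * t ^+ 2) by ring.
    by lra.
  + by apply: lerD => //; exact: inv_sqr.
Qed.

(** One constant for the three bounds, hiding the local [C] and [E]. *)
Lemma small_dft_uniform : exists2 K : R, 0 < K &
  forall n k t, (0 < n)%N -> 0 < t <= 1 -> 2 * M <= Num.sqrt n%:R ->
  [/\ (n %| k.*2)%N -> fine (P (small_dft xi n k t)) <= K / Num.sqrt n%:R,
      ~~ (n %| k.*2)%N -> fine (P (small_dft xi n k t)) <= K / n%:R &
      ~~ (n %| k.*2)%N -> 6 * M * (gcdn k n)%:R <= n%:R * t ->
        fine (P (small_dft xi n k t)) <= K / n%:R ^+ 2 + K * t ^+ 2 / n%:R].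
Proof.
have bounds := small_dft_bounds; have M1 := M_ge1.
move: C C_gt0 E E_gt0 bounds => c c0 e e0 bounds.
have M0 : 0 < M by lra.
have cM : 0 < c * M by rewrite mulr_gt0.
have c2M : c ^+ 2 <= c ^+ 2 * M ^+ 2 by rewrite ler_peMr ?sqr_ge0// expr_ge1// ltW.
have c20 : 0 < c ^+ 2 by rewrite exprn_gt0.
exists (16 * c * M + (4 * e + 64 * c ^+ 2 * M ^+ 2)); first by lra.
move=> n k t n0 t01 nM; have [h1 h2 h3] := bounds n k t n0 t01 nM.
have nV : 0 <= (n%:R : R)^-1 by rewrite invr_ge0.
split=> [/h1|/h2|nk gk].
- move/le_trans; apply; apply: ler_wpM2r; last by lra.
  by rewrite invr_ge0 sqrtr_ge0.
- by move/le_trans; apply; apply: ler_wpM2r => //; lra.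
- apply: le_trans (h3 nk gk) _; apply: lerD.
    by apply: ler_wpM2r; [rewrite invr_ge0 sqr_ge0 | lra].
  by apply: ler_wpM2r => //; apply: ler_wpM2r; [exact: sqr_ge0 | lra].
Qed.

End small_ball_bounds.

(** * Summing the small-ball probabilities over all frequencies *)

Section small_ball_sum.
Context {R : realType} {d : measure_display} {T : measurableType d}.
Variables (P : probability T R) (xi : nat -> {RV P >-> R}).
Hypothesis iid : iid_seq xi.

Lemma sum_small_order n Q : (0 < n)%N ->
  \sum_(k < n) ((n <= Q * gcdn k n)%N)%:R <= (Q.+1%:R) ^+ 2 :> R.
Proof.
move=> n0; rewrite -natr_sum -natrX ler_nat.
apply: leq_trans (card_small_order Q n0).
rewrite -sum1_card [leqRHS]big_mkcond/=.
by apply: leq_sum => k _; rewrite inE; case: (n <= _)%N.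
Qed.

(** Real eigenvalues are thus counted among the frequencies of order at most 2, with the crude bound
    9. *)
Lemma dvdn_double_small_order n k : (0 < n)%N -> (n %| k.*2)%N ->
  (n <= 2 * gcdn k n)%N.
Proof.
move=> n0 nk; apply: dvdn_leq; first by rewrite muln_gt0 gcdn_gt0 n0 orbT.
by rewrite muln_gcdr dvdn_gcd mul2n nk dvdn_mull.
Qed.

(** Three classes are summed: real frequencies at K / sqrt n each, O(1 / t^2) frequencies of small
    order at K / n each, and the remaining ones at the sharp bound. The condition on [t] turns 1 /
    (t^2 n) into 1 / sqrt n. *)
Lemma sum_small_dft : condH (xi 0%N) -> exists2 D : R, 0 < D &
  exists n0 : nat, forall n t, (n0 <= n)%N -> 0 < t <= 1 ->
  1 <= t ^+ 2 * Num.sqrt n%:R ->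
  \sum_(k < n) fine (P (small_dft xi n k t)) <=
  D * ((Num.sqrt n%:R)^-1 + t ^+ 2).
Proof.
move=> /(separated_pair iid)[p [M [p0 M1 sep]]].
have [K K0 bounds] := small_dft_uniform iid p0 M1 sep.
exists (9 * K + 100 * M ^+ 2 * K + 2 * K).
  have : 0 < M ^+ 2 * K by rewrite mulr_gt0// exprn_gt0//; lra.
  lra.
exists (Num.truncn ((2 * M) ^+ 2)).+1 => n t nn0 /[dup] t01 /andP[t0 t1] tn.
have n0 : (0 < n)%N by exact: leq_ltn_trans nn0.
have nR : 0 < n%:R :> R by rewrite ltr0n.
have n1 : 1 <= n%:R :> R by rewrite ler1n.
have M0 : 0 < M by lra.
have nM2 : (2 * M) ^+ 2 <= n%:R.
  have /truncn_itv/andP[_ h] : 0 <= (2 * M) ^+ 2 by exact: sqr_ge0.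
  by apply: le_trans (ltW h) _; rewrite ler_nat.
have nM : 2 * M <= Num.sqrt n%:R.
  by rewrite -[leLHS]ger0_norm -?sqrtr_sqr ?ler_wsqrtr// mulr_ge0// ltW.
set r := Num.sqrt n%:R in tn nM *.
have r0 : 0 < r by rewrite sqrtr_gt0.
have r2 : r ^+ 2 = n%:R by rewrite sqr_sqrtr// ltW.
(* Frequencies failing the order condition of the sharp bound satisfy [n <= Q * gcdn k n]. *)
pose Q := (Num.truncn (6 * M / t)).+1.
have Q1 : 6 * M / t < Q%:R.
  by have /truncn_itv/andP[_] : 0 <= 6 * M / t by rewrite divr_ge0 ?mulr_ge0 ?(ltW M0) ?(ltW t0).
have Q2 : Q.+1%:R <= 8 * M / t.
  have /truncn_itv/andP[h _] : 0 <= 6 * M / t by rewrite divr_ge0 ?mulr_ge0 ?(ltW M0) ?(ltW t0).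
  rewrite /Q -2!natr1; apply: (@le_trans _ _ (6 * M / t + 2 * (M / t))); last by lra.
  have : 1 <= M / t by rewrite ler_pdivlMr// mul1r; lra.
  by move: h; lra.
(* All three bounds are nonnegative, so they are added, the first two with the indicator of their
   class. *)
have pw (k : 'I_n) : fine (P (small_dft xi n k t)) <=
    ((n <= 2 * gcdn k n)%N)%:R * (K / r) + ((n <= Q * gcdn k n)%N)%:R * (K / n%:R) +
    (K / n%:R ^+ 2 + K * t ^+ 2 / n%:R).
  have [b1 b2 b3] := bounds n k t n0 t01 nM.
  have x1 : 0 <= K / r by rewrite divr_ge0 ?(ltW K0) ?(ltW r0).
  have x2 : 0 <= K / n%:R by rewrite divr_ge0 ?(ltW K0).
  have x3 : 0 <= K / n%:R ^+ 2 + K * t ^+ 2 / n%:R.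
    have Kt : 0 <= K * t ^+ 2 by apply: mulr_ge0; [exact: ltW|exact: sqr_ge0].
    by apply: addr_ge0; apply: divr_ge0; rewrite ?sqr_ge0// ltW.
  have [nk|nk] := boolP (n %| k.*2)%N.
    rewrite (dvdn_double_small_order n0 nk) mul1r; apply: le_trans (b1 nk) _.
    by rewrite -addrA lerDl addr_ge0// mulr_ge0.
  have [gk|gk] := leP (6 * M * (gcdn k n)%:R) (n%:R * t).
    apply: le_trans (b3 nk gk) _.
    by rewrite lerDr addr_ge0// mulr_ge0.
  have -> : (n <= Q * gcdn k n)%N.
    rewrite -(ler_nat R) natrM ltW//.
    have : n%:R < 6 * M / t * (gcdn k n)%:R by rewrite mulrAC ltr_pdivlMr.
    by move/lt_le_trans; apply; rewrite ler_wpM2r// ltW.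
  rewrite mul1r; apply: le_trans (b2 nk) _.
  by rewrite addrAC lerDr addr_ge0// mulr_ge0.
apply: (@le_trans _ _ (9 * (K / r) + (8 * M / t) ^+ 2 * (K / n%:R) +
    n%:R * (K / n%:R ^+ 2 + K * t ^+ 2 / n%:R))).
  move: (K / n%:R ^+ 2 + _) pw => Z pw.
  apply: le_trans (ler_sum _ (fun k _ => pw k)) _.
  rewrite !big_split/= -!mulr_suml; apply: lerD; first apply: lerD.
  - apply: ler_wpM2r; first by rewrite divr_ge0 ?(ltW K0) ?(ltW r0).
    by apply: le_trans (sum_small_order 2 n0) _; rewrite -natrX.
  - apply: ler_wpM2r; first by rewrite divr_ge0 ?(ltW K0).
    apply: le_trans (sum_small_order Q n0) _.
    by rewrite ler_pXn2r ?nnegrE// divr_ge0 ?mulr_ge0 ?(ltW M0) ?(ltW t0).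
  - by rewrite sumr_const card_ord mulr_natl.
have rV0 : 0 < r^-1 by rewrite invr_gt0.
have e1 : (8 * M / t) ^+ 2 * (K / n%:R) <= 64 * M ^+ 2 * K / r.
  have -> : (8 * M / t) ^+ 2 * (K / n%:R) = 64 * M ^+ 2 * K * (t ^+ 2 * n%:R)^-1.
    by field; rewrite !gt_eqF.
  apply: ler_wpM2l; first by rewrite !mulr_ge0 ?ler0n ?(ltW K0) ?(ltW M0).
  rewrite lef_pV2 ?posrE// ?mulr_gt0 ?exprn_gt0// -r2 expr2 mulrA.
  by rewrite ler_peMl// ltW.
have e2 : n%:R * (K / n%:R ^+ 2 + K * t ^+ 2 / n%:R) <= K / r + K * t ^+ 2.
  have -> : n%:R * (K / n%:R ^+ 2 + K * t ^+ 2 / n%:R) = K / n%:R + K * t ^+ 2.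
    by field; rewrite gt_eqF.
  rewrite lerD2r; apply: ler_wpM2l; first exact: ltW.
  rewrite lef_pV2 ?posrE// -r2 expr2 ler_peMl//; first exact: ltW.
  by apply: le_trans nM; lra.
have MK : 0 <= M ^+ 2 * K by rewrite mulr_ge0 ?sqr_ge0 ?(ltW K0).
have MKr : 0 <= M ^+ 2 * K / r by rewrite divr_ge0 ?(ltW r0).
have Kr : 0 <= K / r by rewrite divr_ge0 ?(ltW r0) ?(ltW K0).
have Kt : 0 <= K * t ^+ 2 by rewrite mulr_ge0 ?sqr_ge0 ?(ltW K0).
have MKt : 0 <= M ^+ 2 * K * t ^+ 2 by rewrite mulr_ge0 ?sqr_ge0.
lra.
Qed.

End small_ball_sum.

(** * Products of nonnegative functions of independent variables, and Chernoff's bound *)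

Section ge0_products.
Context {R : realType} {d : measure_display} {T : measurableType d}.
Variables (P : probability T R) (xi : nat -> {RV P >-> R}).
Hypothesis iid : iid_seq xi.
Implicit Types (F : T -> R) (g : R -> R) (n : nat).

Let mxi n : measurable_fun setT (xi n : T -> R).
Proof. exact: measurable_funPT. Qed.

Let m_indic_xi k (B : set R) : measurable B ->
  measurable_fun setT (fun w => \1_B (xi k w) : R).
Proof. by move=> mB; apply: measurableT_comp => //; exact: measurable_indic. Qed.

(** The analogue of [indep_tail] for nonnegative integrable functions, since the exponentials below
    need not be bounded. *)
Definition ge0_indep_tail n F := [/\ measurable_fun setT F, forall w, 0 <= F w,
  (\int[P]_w (F w)%:E < +oo)%E &
  forall m (B : nat -> set R), (forall i, measurable (B i)) ->
  (\int[P]_w (F w * \prod_(i < m) \1_(B i) (xi (n + i)%N w))%:E =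
   \int[P]_w (F w)%:E *
   (\prod_(i < m) \int[P]_w \1_(B i) (xi (n + i)%N w))%R%:E)%E].

Lemma ge0_indep_tail0 : ge0_indep_tail 0 (fun=> 1).
Proof.
have e1 : (\int[P]_w (1 : R)%:E = 1)%E.
  rewrite integral_bounded_mfunE; last exact: bounded_mfun_cst.
  by rewrite expect_cst.
split=> //; first by rewrite e1 ltry.
move=> m B mB; rewrite e1 mul1e -expect_prod_indic// -integral_bounded_mfunE.
  by apply: eq_integral => w _; rewrite mul1r.
apply: bounded_mfun_prod => i.
exact: (bounded_mfun_comp (bounded_mfun_indic (mB i)) (mxi i)).
Qed.

Lemma ge0_indep_tailM n F g : ge0_indep_tail n F ->
  measurable_fun setT g -> (forall x, 0 <= g x) ->
  (\int[P]_w (g (xi n w))%:E < +oo)%E ->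
  ge0_indep_tail n.+1 (fun w => F w * g (xi n w)) /\
  (\int[P]_w (F w * g (xi n w))%:E =
   \int[P]_w (F w)%:E * \int[P]_w (g (xi n w))%:E)%E.
Proof.
move=> [mF F0 Ffin hF] mg g0 gfin.
have IF0 : (0 <= \int[P]_w (F w)%:E)%E.
  by apply: integral_ge0 => w _; rewrite lee_fin.
have Ig0 : (0 <= \int[P]_w (g (xi n w))%:E)%E.
  by apply: integral_ge0 => w _; rewrite lee_fin.
have key m (B : nat -> set R) : (forall i, measurable (B i)) ->
    (\int[P]_w (F w * g (xi n w) * \prod_(i < m) \1_(B i) (xi (n.+1 + i)%N w))%:E =
    \int[P]_w (F w)%:E *
    (\prod_(i < m) \int[P]_w \1_(B i) (xi (n.+1 + i)%N w))%R%:E *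
    \int[P]_w (g (xi n w))%:E)%E.
  move=> mB; set Q := fun w => \prod_(i < m) \1_(B i) (xi (n.+1 + i)%N w) : R.
  set q := (\prod_(i < m) _)%R.
  have mQ : measurable_fun setT Q by apply: measurable_prod => i _; exact: m_indic_xi.
  have Q0 w : 0 <= Q w by apply: prodr_ge0 => i _.
  have hB B' : measurable B' -> (\int[P]_w (F w * Q w * \1_B' (xi n w))%:E =
      \int[P]_w (F w)%:E * q%:E * \int[P]_w (\1_B' (xi n w))%:E)%E.
    move=> mB'; pose B'' i := if i is j.+1 then B j else B'.
    have mB'' i : measurable (B'' i) by case: i => //=.
    have := hF m.+1 B'' mB''; rewrite big_ord_recl/= addn0 => e.
    transitivity (\int[P]_w (F w * \prod_(i < m.+1) \1_(B'' i) (xi (n + i)%N w))%:E)%E.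
      apply: eq_integral => w _; rewrite big_ord_recl/= addn0 -mulrA; congr ((_ * _)%:E).
      rewrite mulrC; congr (_ * _); apply: eq_bigr => i _.
      by rewrite /bump/= add1n addnS addSn.
    rewrite e [X in _ = (_ * X)%E]integral_bounded_mfunE; last first.
      exact: (bounded_mfun_comp (bounded_mfun_indic mB') (mxi n)).
    rewrite mulrC EFinM muleA; congr (_ * _%:E * _)%E; apply: eq_bigr => i _.
    by rewrite /bump/= add1n addnS addSn.
  have EG : (\int[P]_w (F w * Q w)%:E = \int[P]_w (F w)%:E * q%:E)%E.
    have := hB setT measurableT.
    under eq_integral do rewrite indicT mulr1.
    under [X in _ = (_ * X)%E]eq_integral do rewrite indicT.
    rewrite [X in _ = (_ * X)%E]integral_bounded_mfunE; last exact: bounded_mfun_cst.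
    by rewrite expect_cst mule1.
  rewrite -EG -ge0_integral_indep//.
  - by apply: eq_integral => w _; rewrite mulrAC.
  - exact: measurable_funM.
  - by move=> w; rewrite mulr_ge0.
  - rewrite EG; apply: lte_mul_pinfty => //; first by rewrite ge0_fin_numE.
    by rewrite ltry.
  - by move=> B' mB'; rewrite hB// EG.
have e0 : (\int[P]_w (F w * g (xi n w))%:E =
   \int[P]_w (F w)%:E * \int[P]_w (g (xi n w))%:E)%E.
  have := key 0%N (fun=> setT) (fun=> measurableT).
  by under eq_integral do rewrite big_ord0 mulr1; rewrite big_ord0 mule1.
split=> //; split.
- by apply: measurable_funM => //; exact: measurableT_comp.
- by move=> w; rewrite mulr_ge0.
- by rewrite e0; apply: lte_mul_pinfty => //; rewrite ge0_fin_numE.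
- by move=> m B mB; rewrite key// e0 muleAC.
Qed.

Lemma integral_prod_le n (f : nat -> R -> R) (b : R) : 0 <= b ->
  (forall j, measurable_fun setT (f j)) -> (forall j x, 0 <= f j x) ->
  (forall j, (\int[P]_w (f j (xi 0%N w))%:E <= b%:E)%E) ->
  (\int[P]_w (\prod_(j < n) f j (xi j w))%:E <= (b ^+ n)%:E)%E.
Proof.
move=> b0 mf f0 fb.
have fbj j : (\int[P]_w (f j (xi j w))%:E <= b%:E)%E.
  rewrite (@ge0_integral_id_distrib _ _ _ _ _ iid j (EFin \o f j)).
  - exact: fb.
  - exact/measurable_EFinP.
  - by move=> x; rewrite /= lee_fin.
suff [] : ge0_indep_tail n (fun w => \prod_(j < n) f j (xi j w)) /\
  (\int[P]_w (\prod_(j < n) f j (xi j w))%:E <= (b ^+ n)%:E)%E by [].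
elim: n => [|n [ih1 ih2]].
  under eq_fun do rewrite big_ord0.
  under eq_integral do rewrite big_ord0.
  split; first exact: ge0_indep_tail0.
  rewrite expr0 integral_bounded_mfunE; last exact: bounded_mfun_cst.
  by rewrite expect_cst.
have [h1 h2] := ge0_indep_tailM ih1 (mf n) (f0 n) (le_lt_trans (fbj n) (ltry _)).
under eq_fun do rewrite big_ord_recr/=.
under eq_integral do rewrite big_ord_recr/=.
split=> //; rewrite h2 exprSr EFinM.
apply: lee_pmul => //; apply: integral_ge0 => w _; rewrite lee_fin//.
by apply: prodr_ge0.
Qed.

(* Chernoff's method, with the moment generating function controlled through a
   pointwise second-order bound, so that truncations [tau] are allowed. *)
Lemma chernoff_sum n (c : nat -> R) (tau H : R -> R) (t U kap : R) :
  measurable_fun setT tau -> 0 < t -> 0 <= kap ->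
  P.-integrable setT (EFin \o (fun w => xi 0%N w)) ->
  \int[P]_w xi 0%N w = 0 ->
  P.-integrable setT (EFin \o (fun w => H (xi 0%N w))) ->
  (forall x, 0 <= H x) ->
  (forall j x, expR (t * (c j * tau x)) <= 1 + t * (c j * x) + kap * H x) ->
  (P [set w | (U <= \sum_(j < n) c j * tau (xi j w))%R] <=
   (expR (n%:R * (kap * \int[P]_w H (xi 0%N w)) - t * U))%:E)%E.
Proof.
move=> mtau t0 k0 ixi Exi iH H0 hexp.
set eta := \int[P]_w H (xi 0%N w).
have me j : measurable_fun setT (fun x => expR (t * (c j * tau x))).
  apply: measurableT_comp; first exact: measurable_expR.
  by do 2 apply: measurable_funM => //.
(* The linear term of the pointwise bound involves the untruncated variable, so its expectation
   vanishes, and 1 + u <= exp u remains. *)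
have eb j : (\int[P]_w (expR (t * (c j * tau (xi 0%N w))))%:E <= (expR (kap * eta))%:E)%E.
  have ic : P.-integrable setT (EFin \o (fun=> 1 : R)).
    exact: (bounded_mfun_integrable P (bounded_mfun_cst 1)).
  have i1 : P.-integrable setT (EFin \o (fun w => t * c j * xi 0%N w)).
    exact: (integrableZl measurableT (t * c j) ixi).
  have i2 : P.-integrable setT (EFin \o (fun w => kap * H (xi 0%N w))).
    exact: (integrableZl measurableT kap iH).
  have i3 : P.-integrable setT (EFin \o (fun w => 1 + t * c j * xi 0%N w)).
    exact: (integrableD measurableT ic i1).
  have i4 : P.-integrable setT
      (EFin \o (fun w => 1 + t * c j * xi 0%N w + kap * H (xi 0%N w))).
    exact: (integrableD measurableT i3 i2).
  apply: (@le_trans _ _ (\int[P]_w (1 + t * c j * xi 0%N w + kap * H (xi 0%N w))%:E)%E).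
    apply: ge0_le_integral.
    - exact: measurableT.
    - by move=> w _; rewrite lee_fin expR_ge0.
    - by apply/measurable_EFinP; apply: (measurableT_comp (me j)).
    - exact: measurable_int i4.
    - by move=> w _; rewrite lee_fin -[t * c j * _]mulrA.
  have -> : (\int[P]_w (1 + t * c j * xi 0%N w + kap * H (xi 0%N w))%:E =
      (1 + kap * eta)%:E)%E.
    rewrite -[LHS]fineK; last exact: (integrable_fin_num measurableT i4).
    congr EFin; rewrite -/(Rintegral P setT _).
    rewrite RintegralD// RintegralD// expect_cst RintegralZl// Exi mulr0 addr0.
    by rewrite RintegralZl.
  by rewrite lee_fin expR_ge1Dx.
have mS : measurable_fun setT (fun w => \sum_(j < n) c j * tau (xi j w)).
  apply: measurable_sum => j; apply: measurable_funM => //.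
  exact: (measurableT_comp mtau).
set A := [set w | _].
have mA : measurable A.
  by rewrite -[X in measurable X]setTI; exact: measurable_fun_le.
have -> : P A = (\int[P]_w (\1_A w)%:E)%E by rewrite integral_indic// setIT.
apply: (@le_trans _ _ (\int[P]_w
   ((expR (- (t * U)))%:E * (\prod_(j < n) expR (t * (c j * tau (xi j w))))%:E))%E).
  have mp : measurable_fun setT (fun w => \prod_(j < n) expR (t * (c j * tau (xi j w)))).
    by apply: measurable_prod => j _; exact: (measurableT_comp (me j)).
  apply: ge0_le_integral.
  - exact: measurableT.
  - by move=> w _; rewrite lee_fin.
  - by apply/measurable_EFinP; exact: measurable_indic.
  - by apply: emeasurable_funM => //; exact/measurable_EFinP.
  - move=> w _; rewrite -EFinM lee_fin -expR_sum -expRD -mulr_sumr indicE.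
    case: (boolP (w \in A)) => [|_]; last exact: expR_ge0.
    rewrite inE /A/= => UA; rewrite -expR0 ler_expR.
    have : t * U <= t * \sum_(j < n) c j * tau (xi j w) by rewrite ler_pM2l.
    lra.
rewrite ge0_integralZl ?lee_fin ?expR_ge0//; last 2 first.
- by apply/measurable_EFinP; apply: measurable_prod => j _; exact: (measurableT_comp (me j)).
- by move=> w _; rewrite lee_fin; apply: prodr_ge0 => j _; exact: expR_ge0.
apply: (@le_trans _ _ ((expR (- (t * U)))%:E * (expR (kap * eta) ^+ n)%:E)%E).
  apply: lee_wpmul2l; first by rewrite lee_fin expR_ge0.
  apply: (@integral_prod_le n (fun j x => expR (t * (c j * tau x)))).
  - exact: expR_ge0.
  - exact: me.
  - by move=> j x; exact: expR_ge0.
  - exact: eb.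
by rewrite -EFinM -expRM_natl -expRD lee_fin ler_expR; lra.
Qed.

End ge0_products.

(** * From tails of the eigenvalues to the condition number *)

Section condition_number_tail.
Context {R : realType} {d : measure_display} {T : measurableType d}.
Variables (P : probability T R) (xi : nat -> {RV P >-> R}).

Let mxi n : measurable_fun setT (xi n : T -> R).
Proof. exact: measurable_funPT. Qed.

Definition large_trig n k (tau : R -> R) (a : R) : set T :=
  [set w | a <= `|\sum_(j < n) cos (theta n k * j%:R) * tau (xi j w)|] `|`
  [set w | a <= `|\sum_(j < n) sin (theta n k * j%:R) * tau (xi j w)|].

Let m_abs_sum n (c : nat -> R) (tau : R -> R) (a : R) : measurable_fun setT tau ->
  measurable [set w | a <= `|\sum_(j < n) c j * tau (xi j w)|].
Proof.
move=> mtau; rewrite -[X in measurable X]setTI; apply: measurable_fun_le => //.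
apply: measurableT_comp => //; apply: measurable_sum => j; apply: measurable_funM => //.
exact: (measurableT_comp mtau).
Qed.

Lemma measurable_large_trig n k tau a : measurable_fun setT tau ->
  measurable (large_trig n k tau a).
Proof.
move=> mtau; apply: measurableU.
  exact: (@m_abs_sum n (fun j => cos (theta n k * j%:R))).
exact: (@m_abs_sum n (fun j => sin (theta n k * j%:R))).
Qed.

(** Four one-sided Chernoff bounds: cosine and sine sums, each with both signs. *)
Lemma large_trig_le n k (tau H : R -> R) (t a kap : R) : iid_seq xi ->
  measurable_fun setT tau -> 0 < t -> 0 <= kap ->
  P.-integrable setT (EFin \o (fun w => xi 0%N w)) ->
  \int[P]_w xi 0%N w = 0 ->
  P.-integrable setT (EFin \o (fun w => H (xi 0%N w))) ->
  (forall x, 0 <= H x) ->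
  (forall c x, `|c| <= 1 -> expR (t * (c * tau x)) <= 1 + t * (c * x) + kap * H x) ->
  (P (large_trig n k tau a) <=
   (4 * expR (n%:R * (kap * \int[P]_w H (xi 0%N w)) - t * a))%:E)%E.
Proof.
move=> iid mtau t0 k0 ixi Exi iH H0 hexp; set b := expR _.
have m_sum (c : nat -> R) : measurable_fun setT (fun w => \sum_(j < n) c j * tau (xi j w)).
  apply: measurable_sum => j; apply: measurable_funM => //.
  exact: (measurableT_comp mtau).
have one (c : nat -> R) : (forall j, `|c j| <= 1) ->
    (P [set w | (a <= `|\sum_(j < n) c j * tau (xi j w)|)%R] <= (2 * b)%:E)%E.
  move=> c1; set A1 := [set w | a <= \sum_(j < n) c j * tau (xi j w)].
  set A2 := [set w | a <= \sum_(j < n) - c j * tau (xi j w)].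
  have mA1 : measurable A1.
    by rewrite -[X in measurable X]setTI; exact: measurable_fun_le.
  have mA2 : measurable A2.
    by rewrite -[X in measurable X]setTI; apply: measurable_fun_le => //; exact: (m_sum (fun j => - c j)).
  apply: (@le_trans _ _ (P (A1 `|` A2))).
    apply: le_measure; rewrite ?inE; [exact: (@m_abs_sum n c tau a mtau) | exact: measurableU |].
    move=> w /=; rewrite ler_normr => /orP[h|h]; [by left | right].
    by rewrite /A2/=; under eq_bigr do rewrite mulNr; rewrite sumrN.
  apply: (le_trans (measureU2 _ mA1 mA2)).
  have -> : (2 * b)%:E = (b%:E + b%:E)%E by rewrite -EFinD; congr EFin; ring.
  apply: leeD.
    apply: (@chernoff_sum _ _ _ P xi iid n c tau H t a kap mtau t0 k0 ixi Exi iH H0) => j x.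
    exact: hexp.
  apply: (@chernoff_sum _ _ _ P xi iid n (fun j => - c j) tau H t a kap mtau t0 k0 ixi Exi iH H0) => j x.
  by apply: hexp; rewrite normrN.
have hc := one (fun j => cos (theta n k * j%:R)) (fun j => cos_max _).
have hs := one (fun j => sin (theta n k * j%:R)) (fun j => sin_max _).
have mc := @m_abs_sum n (fun j => cos (theta n k * j%:R)) tau a mtau.
have ms := @m_abs_sum n (fun j => sin (theta n k * j%:R)) tau a mtau.
apply: (le_trans (measureU2 _ mc ms)).
have -> : (4 * b)%:E = ((2 * b)%:E + (2 * b)%:E)%E by rewrite -EFinD; congr EFin; ring.
exact: leeD hc hs.
Qed.

Let measurable_forall n (Q : 'I_n -> set T) : (forall k, measurable (Q k)) ->
  measurable [set w | forall k, Q k w].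
Proof.
move=> mQ; rewrite (_ : [set w | _] = \bigcap_(k in [set: 'I_n]) Q k).
  by apply: fin_bigcap_measurable.
by apply/seteqP; split=> w h k; [move=> _; exact: h | exact: h].
Qed.

(** The spectral definition does not show measurability; the criterion through finitely many
    inequalities between the [dft_sqr] does. *)
Lemma measurable_kappa_circulant n (c : R) : (0 < n)%N -> 0 <= c ->
  measurable [set w | (kappa (circulant n (fun k => xi k w)) <= c%:E)%E].
Proof.
move=> n0 c0.
have mg k : measurable_fun setT (fun w => dft_sqr n k (fun j => xi j w)).
  by apply: measurable_funD; apply: measurable_funX;
    [exact: measurable_dft_re | exact: measurable_dft_im].
have ms k : measurable_fun setT (fun w => Num.sqrt (dft_sqr n k (fun j => xi j w))).
  apply: (measurableT_comp _ (mg k)); apply: continuous_measurable_fun.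
  exact: sqrt_continuous.
rewrite (_ : [set w | _] =
  [set w | forall k : 'I_n, [set w | 0 < dft_sqr n k (fun j => xi j w)] w] `&`
  [set w | forall k : 'I_n, [set w | forall l : 'I_n,
    [set w | Num.sqrt (dft_sqr n k (fun j => xi j w)) <=
             c * Num.sqrt (dft_sqr n l (fun j => xi j w))] w] w]).
  apply: measurableI; apply: measurable_forall => k.
    rewrite (_ : [set w | _] = ~` [set w | dft_sqr n k (fun j => xi j w) <= 0]).
      apply: measurableC; rewrite -[X in measurable X]setTI.
      exact: measurable_fun_le.
    apply/seteqP; split=> w /=; last by move=> /negP; rewrite -ltNge.
    by move=> h; apply/negP; rewrite -ltNge.
  apply: measurable_forall => l; rewrite -[X in measurable X]setTI.
  by apply: measurable_fun_le => //; exact: measurable_funM.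
apply/seteqP; split=> w /=.
  by move=> /kappa_circulant_le -/(_ n0 c0)[h1 h2]; split.
by move=> [h1 h2]; apply/kappa_circulant_le.
Qed.

(** Off [B] every eigenvalue has modulus at most [U]; off the small-ball events every modulus
    exceeds [t]. All ratios are then at most [c], and a union bound concludes. *)
Lemma kappa_circulant_prob n (t U c : R) (B : set T) : (0 < n)%N -> 0 < t ->
  0 <= U -> U <= c * t -> measurable B ->
  (forall w, ~ B w -> forall k : 'I_n,
    `|dft_re n k (fun j => xi j w)| <= U / 2 /\
    `|dft_im n k (fun j => xi j w)| <= U / 2) ->
  ((1 - (fine (P B) + \sum_(k < n) fine (P (small_dft xi n k t))))%:E <=
   P [set w | (kappa (circulant n (fun k => xi k w)) <= c%:E)%E])%E.
Proof.
move=> n0 t0 U0 Uct mB hB.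
have c0 : 0 <= c by rewrite -(pmulr_lge0 _ t0) (le_trans U0).
have mG := measurable_kappa_circulant n0 c0.
set G := [set w | _] in mG *.
pose S := \big[setU/set0]_(k < n) small_dft xi n k t.
have mS : measurable S.
  by apply: bigsetU_measurable => k _; exact: measurable_small_dft.
have sub : ~` (B `|` S) `<=` G.
  move=> w /not_orP[nB nS].
  have nSk (k : 'I_n) : t ^+ 2 < dft_sqr n k (fun j => xi j w).
    rewrite ltNge; apply/negP => h; apply: nS.
    rewrite /S -(bigcup_mkord n (fun k => small_dft xi n k t)); exists k => /=//.
    have tt : 0 <= t by exact: ltW.
    split=> /=; rewrite -(@ler_pXn2r _ 2)// ?nnegrE// real_normK ?num_real//;
      apply: le_trans h; rewrite /dft_sqr ?lerDl ?lerDr sqr_ge0//.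
  have bk (k : 'I_n) : Num.sqrt (dft_sqr n k (fun j => xi j w)) <= U.
    have [h1 h2] := hB w nB k.
    rewrite -[leRHS]ger0_norm// -sqrtr_sqr ler_wsqrtr// /dft_sqr.
    have s1 : dft_re n k (fun j => xi j w) ^+ 2 <= (U / 2) ^+ 2.
      by rewrite -[leLHS]real_normK ?num_real// ler_pXn2r ?nnegrE ?divr_ge0.
    have s2 : dft_im n k (fun j => xi j w) ^+ 2 <= (U / 2) ^+ 2.
      by rewrite -[leLHS]real_normK ?num_real// ler_pXn2r ?nnegrE ?divr_ge0.
    rewrite (le_trans (lerD s1 s2))// exprMn; have := sqr_ge0 U.
    by rewrite exprVn (_ : 2 ^+ 2 = 4 :> R); [lra|ring].
  apply/kappa_circulant_le => //; split=> [k|k l].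
    by apply: lt_trans (nSk k); rewrite exprn_gt0.
  apply: le_trans (bk k) _; apply: le_trans Uct _; apply: ler_wpM2l => //.
  rewrite -[leLHS]ger0_norm; last exact: ltW.
  by rewrite -sqrtr_sqr ler_wsqrtr// ltW.
apply: (@le_trans _ _ (P (~` (B `|` S)))); last first.
  by apply: le_measure; rewrite ?inE//; apply: measurableC; exact: measurableU.
rewrite probability_setC; last exact: measurableU.
have fk (k : 'I_n) : P (small_dft xi n k t) = (fine (P (small_dft xi n k t)))%:E.
  by rewrite fineK// fin_num_measure//; exact: measurable_small_dft.
have PBS : (P (B `|` S) <=
    (fine (P B) + \sum_(k < n) fine (P (small_dft xi n k t)))%:E)%E.
  apply: le_trans (measureU2 _ mB mS) _.
  rewrite EFinD fineK ?fin_num_measure// leeD2lE ?fin_num_measure//.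
  apply: (@le_trans _ _ (\sum_(k < n) P (small_dft xi n k t))%E).
    apply: (@Boole_inequality _ _ _ P (fun k => small_dft xi n k t) n).
    by move=> i _; exact: measurable_small_dft.
  by rewrite -sumEFin; apply: lee_sum => k _; rewrite fk.
have fBS : P (B `|` S) \is a fin_num by rewrite fin_num_measure//; exact: measurableU.
by rewrite EFinB leeB.
Qed.

End condition_number_tail.

(** * Asymptotics of the scales *)

Section asymptotics.
Context {R : realType}.

Lemma powR_nat_eventually (a K : R) : 0 < a ->
  exists N : nat, forall n : nat, (N <= n)%N -> K <= n%:R `^ a.
Proof.
move=> a0; exists (Num.truncn (`|K| `^ a^-1)).+1 => n nN.
have h : `|K| `^ a^-1 <= n%:R.
  have /truncn_itv/andP[_ h] : 0 <= `|K| `^ a^-1 by exact: powR_ge0.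
  by apply: le_trans (ltW h) _; rewrite ler_nat.
apply: (le_trans (ler_norm K)).
have -> : `|K| = (`|K| `^ a^-1) `^ a.
  by rewrite -powRrM mulVf ?gt_eqF// powRr1.
by apply: ge0_ler_powR; rewrite ?nnegrE ?powR_ge0//; exact: ltW.
Qed.

Lemma ln_nat_le_sqrt n : ln n%:R <= 2 * Num.sqrt n%:R :> R.
Proof.
case: n => [|n]; first by rewrite ln0// sqrtr0 mulr0.
set r := Num.sqrt _; have r0 : 0 < r by rewrite sqrtr_gt0 ltr0n.
have -> : n.+1%:R = r ^+ 2 :> R by rewrite sqr_sqrtr.
rewrite lnXn// -[leLHS]mulr_natl ler_pM2l//.
have h := @le_ln1Dx _ (r - 1); rewrite (_ : 1 + (r - 1) = r) in h; last by ring.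
by apply: (le_trans (h _)); lra.
Qed.

(** The range of [rho] enters here: [rho > 0] makes the scale t = eps n^(-rho) at most 1, and
    [1 / 2 - 2 * rho > 0] makes t^2 sqrt n grow. *)
Lemma scale_eventually (eps rho : R) : 0 < eps -> 0 < rho < 1 / 4 ->
  exists N : nat, forall n : nat, (N <= n)%N -> (0 < n)%N ->
  [/\ 0 < eps * n%:R `^ (- rho), eps * n%:R `^ (- rho) <= 1 &
      1 <= (eps * n%:R `^ (- rho)) ^+ 2 * Num.sqrt n%:R].
Proof.
move=> e0 /andP[r0 r1].
have [N1 h1] := powR_nat_eventually eps r0.
have a0 : 0 < 1 / 2 - 2 * rho by lra.
have [N2 h2] := powR_nat_eventually (eps ^- 2) a0.
exists (maxn N1 N2) => n; rewrite geq_max => /andP[n1 n2] n0.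
have nR : 0 < n%:R :> R by rewrite ltr0n.
have p0 a : 0 < n%:R `^ a :> R by rewrite powR_gt0.
split; first by rewrite mulr_gt0.
  by rewrite powRN ler_pdivrMr// mul1r h1.
have -> : (eps * n%:R `^ (- rho)) ^+ 2 * Num.sqrt n%:R =
    eps ^+ 2 * n%:R `^ (1 / 2 - 2 * rho).
  rewrite exprMn -mulrA; congr (_ * _).
  rewrite -powR_mulrn; last exact: ltW.
  rewrite -powRrM -powR12_sqrt; last exact: ltW.
  rewrite -powRD; last by rewrite pnatr_eq0 -lt0n n0 implybT.
  by congr (_ `^ _); lra.
rewrite -(ler_pM2l (_ : 0 < eps ^- 2)); last by rewrite invr_gt0 exprn_gt0.
rewrite mulr1 mulrA mulVf; first by rewrite [leRHS]mul1r; exact: h2.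
by rewrite gt_eqF// exprn_gt0.
Qed.

Lemma powR_neg_half n : n%:R `^ (- (1 / 2)) = (Num.sqrt n%:R)^-1 :> R.
Proof. by rewrite powRN div1r powR12_sqrt. Qed.

(** The powers of [n] and of [eps] cancel: threshold times lower scale is the upper bound required
    of the eigenvalues. *)
Lemma scaled_threshold n (C eps rho L : R) : (0 < n)%N -> 0 < eps ->
  C / eps * n%:R `^ (rho + 1 / 2) * L * (eps * n%:R `^ (- rho)) =
  C * (Num.sqrt n%:R * L).
Proof.
move=> n0 e0; have nR : 0 < n%:R :> R by rewrite ltr0n.
have p0 : 0 < n%:R `^ rho :> R by rewrite powR_gt0.
rewrite powRD; last by rewrite pnatr_eq0 -lt0n n0 implybT.
rewrite powRN div1r powR12_sqrt; last exact: ltW.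
by field; rewrite !gt_eqF.
Qed.

End asymptotics.

(** * Total small-ball probability, and the case of exponential moments *)

Section main_estimates.
Context {R : realType} {d : measure_display} {T : measurableType d}.
Variables (P : probability T R) (xi : nat -> {RV P >-> R}).
Hypothesis iid : iid_seq xi.

Lemma small_dft_total : condH (xi 0%N) -> exists2 D : R, 0 < D &
  forall eps rho : R, 0 < eps -> 0 < rho < 1 / 4 ->
  exists N : nat, forall n : nat, (N <= n)%N -> (0 < n)%N ->
  \sum_(k < n) fine (P (small_dft xi n k (eps * n%:R `^ (- rho)))) <=
  D * ((Num.sqrt n%:R)^-1 + (eps ^+ 2 + eps) * n%:R `^ (- (2 * rho))).
Proof.
move=> /(sum_small_dft iid)[D D0 [N1 h1]]; exists D => // eps rho e0 r01.
have [N2 h2] := scale_eventually e0 r01.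
exists (maxn N1 N2) => n; rewrite geq_max => /andP[n1 n2] n0.
have [t0 t1 tn] := h2 n n2 n0.
apply: le_trans (h1 n _ n1 _ tn) _; first by rewrite t0.
rewrite ler_pM2l// lerD2l exprMn -[(n%:R `^ _) ^+ 2]powR_mulrn ?powR_ge0// -powRrM.
have -> : - rho * 2 = - (2 * rho) by ring.
by rewrite ler_wpM2r ?powR_ge0//; lra.
Qed.

Lemma large_trig_union n (tau : R -> R) (a b : R) : measurable_fun setT tau ->
  (forall k, (P (large_trig xi n k tau a) <= b%:E)%E) ->
  (P (\big[setU/set0]_(k < n) large_trig xi n k tau a) <= (n%:R * b)%:E)%E.
Proof.
move=> mtau h.
apply: le_trans (@Boole_inequality _ _ _ P (fun k => large_trig xi n k tau a) n _) _.
  by move=> i _; exact: measurable_large_trig.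
apply: (@le_trans _ _ (\sum_(k < n) b%:E)%E); first by apply: lee_sum => k _; exact: h.
by rewrite sumEFin sumr_const card_ord mulr_natl.
Qed.

Lemma not_large_trig_union n (tau : R -> R) (a : R) w :
  ~ (\big[setU/set0]_(k < n) large_trig xi n k tau a) w -> forall k : 'I_n,
  `|dft_re n k (fun j => tau (xi j w))| <= a /\
  `|dft_im n k (fun j => tau (xi j w))| <= a.
Proof.
rewrite -(bigcup_mkord n (fun k => large_trig xi n k tau a)) => nB k.
have : ~ large_trig xi n k tau a w by move=> h; apply: nB; exists k => //=.
move=> /not_orP[/negP + /negP]; rewrite -!ltNge => h1 h2.
rewrite /dft_re /dft_im; split.
  by under eq_bigr do rewrite mulrC; exact: ltW.
by under eq_bigr do rewrite mulrC; exact: ltW.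
Qed.

(** Chernoff's bound at sqrt (ln n / n) makes each frequency fail with probability at most 4 / n^2,
    so all of them together with at most 4 / n. *)
Lemma kappa_upper_exp (t0 : R) : condH (xi 0%N) ->
  P.-integrable setT (EFin \o xi 0%N) -> ('E_P[xi 0%N] = 0)%E -> 0 < t0 ->
  (forall t : R, -t0 < t < t0 ->
    P.-integrable setT (EFin \o (fun w => expR (t * xi 0%N w)))) ->
  exists C0 C1 : R, [/\ 0 < C0, 0 < C1 &
  forall eps rho : R, 0 < eps -> 0 < rho < 1 / 4 ->
  exists N : nat, forall n : nat, (N <= n)%N ->
   ((1 - C1 * ((eps ^+ 2 + eps) * n%:R `^ (- (2 * rho)) + (Num.sqrt n%:R)^-1))%:E <=
    P [set w | (kappa (circulant n (fun k => xi k w))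
        <= (C0 / eps * n%:R `^ (rho + 1 / 2) * Num.sqrt (ln n%:R))%:E)%E])%E].
Proof.
move=> hH ixi Exi t00 mgf.
have [D D0 hD] := small_dft_total hH.
have Exi0 : \int[P]_w xi 0%N w = 0.
  by move: Exi; rewrite expectation_def /Rintegral => ->.
(* Of the exponential rate [s], allowed by the hypothesis, one half [a] absorbs the factor [x ^ 2]
   and the other covers the Chernoff parameter. *)
pose s := t0 / 2; pose a := s / 2.
have a0 : 0 < a by rewrite !divr_gt0.
have sE : s = 2 * a by rewrite /a; field.
pose H x : R := 4 / a ^+ 2 * (expR (s * x) + expR (- s * x)).
have H0 x : 0 <= H x by rewrite mulr_ge0 ?divr_ge0 ?sqr_ge0 ?addr_ge0 ?expR_ge0.
have iH : P.-integrable setT (EFin \o (fun w => H (xi 0%N w))).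
  have s1 : - t0 < s < t0 by rewrite /s; lra.
  have s2 : - t0 < - s < t0 by rewrite /s; lra.
  exact: (integrableZl measurableT (4 / a ^+ 2)
    (integrableD measurableT (mgf _ s1) (mgf _ s2))).
(* [x ^ 2 <= 4 / a ^ 2 * exp (a |x|)] absorbs the quadratic factor. *)
have hexp t c x : 0 < t <= a -> `|c| <= 1 ->
    expR (t * (c * x)) <= 1 + t * (c * x) + t ^+ 2 * H x.
  move=> /andP[tp ta] c1; apply: le_trans (expR_le_quadratic _) _.
  rewrite lerD2l exprMn -mulrA ler_wpM2l ?sqr_ge0//.
  have c2 : c ^+ 2 <= 1 by rewrite -[leLHS]real_normK ?num_real// expr_le1.
  have y0 : 0 <= a * `|x| by rewrite mulr_ge0// ltW.
  have e1 : expR `|t * (c * x)| <= expR (a * `|x|).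
    rewrite ler_expR !normrM (gtr0_norm tp); apply: ler_pM => //; first exact: ltW.
    by rewrite ler_piMl.
  have e2 : x ^+ 2 <= 4 / a ^+ 2 * expR (a * `|x|).
    have h := sqr_half_le_expR y0.
    rewrite mulrAC ler_pdivlMr ?exprn_gt0//.
    move: h; rewrite exprMn exprMn real_normK ?num_real//; lra.
  have e3 : expR (a * `|x|) * expR (a * `|x|) <= expR (s * x) + expR (- s * x).
    rewrite -expRD -mulrDl -(mulr2n a) -mulr_natl -sE.
    have [x0|x0] := leP 0 x; first by rewrite ger0_norm// lerDl expR_ge0.
    by rewrite ltr0_norm// mulNr -mulrN lerDr expR_ge0.
  apply: (@le_trans _ _ (x ^+ 2 * expR (a * `|x|))).
    apply: ler_pM => //; rewrite ?sqr_ge0 ?expR_ge0//.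
    by rewrite exprMn ler_piMl ?sqr_ge0.
  apply: (@le_trans _ _ (4 / a ^+ 2 * expR (a * `|x|) * expR (a * `|x|))).
    by rewrite ler_wpM2r// expR_ge0.
  by rewrite -mulrA ler_wpM2l// divr_ge0// sqr_ge0.
set eta := \int[P]_w H (xi 0%N w).
have eta0 : 0 <= eta by apply: Rintegral_ge0.
(* This choice makes the Chernoff exponent eta q^2 - A q^2 equal to - 2 ln n. *)
pose A := eta + 2.
have A0 : 0 < A by rewrite /A; lra.
exists (2 * A), (4 + D); split; [by rewrite mulr_gt0|by lra|].
move=> eps rho e0 r01; have [N1 h1] := hD eps rho e0 r01.
(* Together with ln n <= 2 sqrt n, this puts the Chernoff parameter below [a]. *)
have [|N2 h2] := @powR_nat_eventually R (1 / 2) (2 / a ^+ 2); first by lra.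
exists (maxn N1 (maxn N2 2)) => n; rewrite !geq_max => /and3P[n1 n2 n3].
have n0 : (0 < n)%N by exact: ltnW.
have nR : 0 < n%:R :> R by rewrite ltr0n.
have nR1 : 1 <= n%:R :> R by rewrite ler1n.
set r := Num.sqrt n%:R; set q := Num.sqrt (ln n%:R).
have r0 : 0 < r by rewrite sqrtr_gt0.
have r2 : r ^+ 2 = n%:R by rewrite sqr_sqrtr// ltW.
have r1 : 1 <= r by rewrite -sqrtr1 ler_wsqrtr.
have lnn0 : 0 < ln n%:R :> R by rewrite ln_gt0// ltr1n.
have q0 : 0 < q by rewrite sqrtr_gt0.
have q2 : q ^+ 2 = ln n%:R by rewrite sqr_sqrtr// ltW.
have qra : 0 < q / r <= a.
  rewrite divr_gt0//= -[leLHS]ger0_norm; last by rewrite divr_ge0 ?(ltW q0) ?(ltW r0).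
  rewrite -(@ger0_norm _ a (ltW a0)) -!sqrtr_sqr ler_wsqrtr// expr_div_n q2 r2.
  rewrite ler_pdivrMr// (le_trans (ln_nat_le_sqrt n))// -/r -r2.
  have := h2 n n2; rewrite div1r powR12_sqrt ?(ltW nR)// -/r.
  rewrite ler_pdivrMr ?exprn_gt0// => h; rewrite expr2 mulrA ler_wpM2r ?(ltW r0)//.
  by rewrite mulrC.
have mid : measurable_fun setT (@id R) by [].
have lt k : (P (large_trig xi n k id (A * (r * q))) <= (4 * n%:R ^- 2)%:E)%E.
  have := @large_trig_le _ _ _ P xi n k id H (q / r) (A * (r * q)) ((q / r) ^+ 2) iid
    mid (andP qra).1 (sqr_ge0 _) ixi Exi0 iH H0
    (fun c x c1 => hexp _ c x qra c1).
  congr (_ <= (4 * _)%:E)%E.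
  have -> : n%:R * ((q / r) ^+ 2 * \int[P]_w H (xi 0%N w)) - q / r * (A * (r * q)) =
      - (2 * ln n%:R).
    rewrite -/eta expr_div_n r2 /A -q2; field; by rewrite !gt_eqF.
  by rewrite expRN expRM_natl lnK ?posrE.
have PB := large_trig_union mid lt.
set B := \big[setU/set0]_(k < n) _ in PB.
have mB : measurable B.
  by apply: bigsetU_measurable => k _; exact: measurable_large_trig.
have tp : 0 < eps * n%:R `^ (- rho) by rewrite mulr_gt0 ?powR_gt0.
have U0 : 0 <= 2 * A * (r * q) by rewrite !mulr_ge0 ?(ltW A0) ?(ltW r0) ?(ltW q0).
have Uct : 2 * A * (r * q) <=
    2 * A / eps * n%:R `^ (rho + 1 / 2) * q * (eps * n%:R `^ (- rho)).
  by rewrite scaled_threshold.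
apply: le_trans (kappa_circulant_prob (B := B) n0 tp U0 Uct mB _); last first.
  move=> w nB k; have := not_large_trig_union nB k.
  by have -> : 2 * A * (r * q) / 2 = A * (r * q) by field.
have fB : fine (P B) <= 4 * r^-1.
  rewrite -lee_fin fineK ?fin_num_measure//; apply: le_trans PB _; rewrite lee_fin.
  have -> : n%:R * (4 * n%:R ^- 2) = 4 * (n%:R : R)^-1 by field; rewrite gt_eqF.
  rewrite ler_pM2l// lef_pV2 ?posrE// -r2 expr2 ler_peMl// ltW//.
have hs := h1 n n1 n0; rewrite -/r in hs.
rewrite lee_fin lerB// (le_trans (lerD fB hs))//.
have : 0 <= (eps ^+ 2 + eps) * n%:R `^ (- (2 * rho)).
  by rewrite mulr_ge0 ?powR_ge0// addr_ge0 ?sqr_ge0// ltW.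
by move: ((eps ^+ 2 + eps) * _) => X X0; have := invr_ge0 r; rewrite (ltW r0); nra.
Qed.

End main_estimates.

(** * The case of a finite second moment, by truncation *)

Section second_moment.
Context {R : realType} {d : measure_display} {T : measurableType d}.
Variables (P : probability T R) (xi : nat -> {RV P >-> R}).
Hypothesis iid : iid_seq xi.

Let mxi n : measurable_fun setT (xi n : T -> R).
Proof. exact: measurable_funPT. Qed.

Lemma markov_sum_sqr n (L : R) : 0 < L ->
  P.-integrable setT (EFin \o (fun w => xi 0%N w ^+ 2)) ->
  (P [set w | (L <= \sum_(j < n) xi j w ^+ 2)%R] <=
   (L^-1 * (n%:R * \int[P]_w (xi 0%N w ^+ 2)))%:E)%E.
Proof.
move=> L0 i2; set A := [set w | _].
have m2 j : measurable_fun setT (fun w => xi j w ^+ 2) by exact: measurable_funX.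
have mS : measurable_fun setT (fun w => \sum_(j < n) xi j w ^+ 2).
  by apply: measurable_sum => j.
have mA : measurable A.
  by rewrite -[X in measurable X]setTI; exact: measurable_fun_le.
have -> : P A = (\int[P]_w (\1_A w)%:E)%E by rewrite integral_indic// setIT.
apply: (@le_trans _ _ (\int[P]_w (L^-1%:E * (\sum_(j < n) xi j w ^+ 2)%:E))%E).
  apply: ge0_le_integral.
  - exact: measurableT.
  - by move=> w _; rewrite lee_fin.
  - by apply/measurable_EFinP; exact: measurable_indic.
  - by apply: emeasurable_funM => //; exact/measurable_EFinP.
  - move=> w _; rewrite -EFinM lee_fin indicE mulrC.
    case: (boolP (w \in A)) => [|_]; first by rewrite inE ler_pdivlMr// mul1r.
    by rewrite divr_ge0 ?(ltW L0)// sumr_ge0// => j _; exact: sqr_ge0.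
rewrite ge0_integralZl ?lee_fin ?invr_ge0 ?(ltW L0)//; last 2 first.
- exact/measurable_EFinP.
- by move=> w _; rewrite lee_fin sumr_ge0// => j _; exact: sqr_ge0.
rewrite EFinM lee_pmul2l ?lte_fin ?invr_gt0//.
under eq_integral do rewrite -sumEFin.
rewrite ge0_integral_sum//; last 2 first.
- by move=> j; exact/measurable_EFinP.
- by move=> j w _; rewrite lee_fin sqr_ge0.
have e j : (\int[P]_w (xi j w ^+ 2)%:E = (\int[P]_w (xi 0%N w ^+ 2))%:E)%E.
  rewrite (@ge0_integral_id_distrib _ _ _ _ _ iid j (fun x => (x ^+ 2)%:E)).
  - rewrite /Rintegral fineK//; exact: (integrable_fin_num measurableT i2).
  - by apply/measurable_EFinP; exact: measurable_funX.
  - by move=> x; rewrite lee_fin sqr_ge0.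
under eq_bigr do rewrite e.
by rewrite sumEFin sumr_const card_ord mulr_natl.
Qed.

Definition truncate (r x : R) : R := if `|x| <= r then x else 0.

Lemma measurable_truncate r : measurable_fun setT (truncate r).
Proof. by apply: measurable_fun_ifT => //; exact: measurable_fun_ler. Qed.

(** Where the truncation acts, [|x|] exceeds [r], so [|x|] is at most [x ^ 2 / r]. *)
Lemma truncate_dist (r x : R) : 0 < r -> `|x - truncate r x| <= x ^+ 2 / r.
Proof.
move=> r0; rewrite /truncate; have [_|h] := leP `|x| r.
  by rewrite subrr normr0 divr_ge0 ?sqr_ge0 ?(ltW r0).
rewrite subr0 ler_pdivlMr// -[x ^+ 2]real_normK ?num_real// expr2.
by rewrite ler_wpM2l// ltW.
Qed.

(** For [|x| <= r] the exponent is at most 1 in absolute value. For larger [x] the left side is 1,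
    and the linear term, at least - |x| / r, is absorbed by the quadratic one. Keeping [x] itself in
    the linear term preserves the zero mean. *)
Lemma expR_truncate_le (r c x : R) : 0 < r -> `|c| <= 1 ->
  expR (r^-1 * (c * truncate r x)) <=
  1 + r^-1 * (c * x) + r ^- 2 * ((1 + expR 1) * x ^+ 2).
Proof.
move=> r0 c1; set z := r^-1 * `|x|.
have z0 : 0 <= z by rewrite mulr_ge0 ?invr_ge0 ?(ltW r0).
have zE : r ^- 2 * x ^+ 2 = z ^+ 2 by rewrite exprMn exprVn real_normK ?num_real.
have cz : `|r^-1 * (c * x)| <= z.
  rewrite !normrM (@gtr0_norm _ r^-1) ?invr_gt0// ler_wpM2l ?invr_ge0 ?(ltW r0)//.
  by rewrite ler_piMl.
rewrite [r ^- 2 * _]mulrCA zE; have e0 := expR_gt0 (1 : R).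
rewrite /truncate; have [h|h] := leP `|x| r.
  have z1 : z <= 1 by rewrite /z mulrC ler_pdivrMr// mul1r.
  apply: le_trans (expR_le_quadratic _) _; rewrite lerD2l.
  set y := r^-1 * (c * x) in cz *.
  have y2 : y ^+ 2 <= z ^+ 2 by rewrite -[leLHS]real_normK ?num_real// ler_pXn2r ?nnegrE.
  have ey : expR `|y| <= expR 1 by rewrite ler_expR (le_trans cz).
  apply: (@le_trans _ _ (z ^+ 2 * expR 1)).
    by apply: ler_pM => //; exact: sqr_ge0.
  by rewrite mulrC ler_wpM2r ?sqr_ge0//; lra.
have z1 : 1 <= z by rewrite /z mulrC ler_pdivlMr// mul1r ltW.
rewrite !mulr0 expR0; move: cz; rewrite ler_norml => /andP[cz _].
have : z <= z ^+ 2 by rewrite expr2 ler_peMl.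
have : 0 <= expR 1 * z ^+ 2 by rewrite mulr_ge0 ?expR_ge0 ?sqr_ge0.
lra.
Qed.

Lemma dft_truncate_le n k (r a L : R) w : 0 < r ->
  \sum_(j < n) xi j w ^+ 2 <= L ->
  `|dft_re n k (fun j => truncate r (xi j w))| <= a /\
  `|dft_im n k (fun j => truncate r (xi j w))| <= a ->
  `|dft_re n k (fun j => xi j w)| <= a + L / r /\
  `|dft_im n k (fun j => xi j w)| <= a + L / r.
Proof.
move=> r0 SL.
have key (g : nat -> R) : (forall j, `|g j| <= 1) ->
    `|\sum_(j < n) truncate r (xi j w) * g j| <= a ->
    `|\sum_(j < n) xi j w * g j| <= a + L / r.
  move=> g1 ha.
  have -> : \sum_(j < n) xi j w * g j = \sum_(j < n) truncate r (xi j w) * g j +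
      \sum_(j < n) (xi j w - truncate r (xi j w)) * g j.
    by rewrite -big_split/=; apply: eq_bigr => j _; ring.
  apply: le_trans (ler_normD _ _) _; apply: lerD => //.
  apply: le_trans (ler_norm_sum _ _ _) _.
  apply: (@le_trans _ _ (\sum_(j < n) xi j w ^+ 2 / r)).
    apply: ler_sum => j _; rewrite normrM.
    by rewrite (le_trans _ (truncate_dist (xi j w) r0))// ler_piMr.
  by rewrite -mulr_suml ler_wpM2r ?invr_ge0 ?(ltW r0).
move=> [h1 h2]; split.
  by apply: (key (fun j => cos (theta n k * j%:R))) => // j; exact: cos_max.
by apply: (key (fun j => sin (theta n k * j%:R))) => // j; exact: sin_max.
Qed.

(** Chernoff's bound fails with probability at most 4 exp(eta) / n, and Markov's at level n ln n
    with at most sig / ln n; both are dominated by a constant over sqrt (ln n). *)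
Lemma kappa_upper_sqr : condH (xi 0%N) ->
  P.-integrable setT (EFin \o xi 0%N) -> ('E_P[xi 0%N] = 0)%E ->
  P.-integrable setT (EFin \o (fun w => xi 0%N w ^+ 2)) ->
  exists C0 C2 : R, [/\ 0 < C0, 0 < C2 &
  forall eps rho : R, 0 < eps -> 0 < rho < 1 / 4 ->
  exists N : nat, forall n : nat, (N <= n)%N ->
   ((1 - C2 * ((eps ^+ 2 + eps) * n%:R `^ (- (2 * rho)) + (Num.sqrt (ln n%:R))^-1))%:E <=
    P [set w | (kappa (circulant n (fun k => xi k w))
        <= (C0 / eps * n%:R `^ (rho + 1 / 2) * ln n%:R)%:E)%E])%E].
Proof.
move=> hH ixi Exi i2.
have [D D0 hD] := small_dft_total iid hH.
have Exi0 : \int[P]_w xi 0%N w = 0.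
  by move: Exi; rewrite expectation_def /Rintegral => ->.
set sig := \int[P]_w (xi 0%N w ^+ 2).
have sig0 : 0 <= sig by apply: Rintegral_ge0 => w _; exact: sqr_ge0.
pose H x : R := (1 + expR 1) * x ^+ 2.
have H0 x : 0 <= H x by rewrite mulr_ge0 ?sqr_ge0// addr_ge0 ?expR_ge0.
have iH : P.-integrable setT (EFin \o (fun w => H (xi 0%N w))).
  exact: (integrableZl measurableT (1 + expR 1) i2).
set eta := \int[P]_w H (xi 0%N w).
have e0 : 0 < expR eta by exact: expR_gt0.
(* Half of 6 splits as 2 + 1: twice sqrt n ln n for the truncated sums, once for the discarded
   part. *)
exists 6, (sig + 4 * expR eta + D); split => //; first by lra.
move=> eps rho ep0 r01; have [N1 h1] := hD eps rho ep0 r01.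
(* The second index forces [n >= expR 1], hence [ln n >= 1] and sqrt (ln n) <= ln n. *)
exists (maxn N1 (Num.truncn (expR 1 : R)).+2) => n; rewrite geq_max => /andP[n1 n3].
have n0 : (0 < n)%N by exact: leq_trans n3.
have nR : 0 < n%:R :> R by rewrite ltr0n.
have nR1 : 1 <= n%:R :> R by rewrite ler1n.
have ne : expR 1 <= n%:R :> R.
  have /truncn_itv/andP[_ h] : 0 <= expR 1 :> R by exact: expR_ge0.
  by apply: le_trans (ltW h) _; rewrite ler_nat ltnW.
pose r : R := Num.sqrt n%:R; set l := ln n%:R.
have r0 : 0 < r by rewrite sqrtr_gt0.
have r2 : r ^+ 2 = n%:R by rewrite sqr_sqrtr// ltW.
have r1 : 1 <= r by rewrite -sqrtr1 ler_wsqrtr.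
have l1 : 1 <= l by rewrite -[leLHS]expRK ler_ln ?posrE ?expR_gt0.
have l0 : 0 < l by lra.
have ln_le : l <= n%:R.
  have := @le_ln1Dx R (n%:R - 1); rewrite (_ : 1 + (n%:R - 1) = n%:R); last by ring.
  by move=> h; apply: (le_trans (h _)); lra.
set q := Num.sqrt l.
have q1 : 1 <= q by rewrite -sqrtr1 ler_wsqrtr.
have q0 : 0 < q by lra.
have q2 : q ^+ 2 = l by rewrite sqr_sqrtr// ltW.
have qr : q <= r by rewrite ler_wsqrtr.
have mtau := @measurable_truncate r.
have lt k : (P (large_trig xi n k (truncate r) (2 * (r * l))) <=
    (4 * (expR eta * n%:R ^- 2))%:E)%E.
  have := @large_trig_le _ _ _ P xi n k (truncate r) H r^-1 (2 * (r * l)) (r ^- 2) iid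
    mtau _ _ ixi Exi0 iH H0 (fun c x c1 => expR_truncate_le x r0 c1).
  rewrite invr_gt0 => /(_ r0); rewrite invr_ge0 sqr_ge0 => /(_ isT).
  congr (_ <= (4 * _)%:E)%E.
  have -> : n%:R * (r ^- 2 * \int[P]_w H (xi 0%N w)) - r^-1 * (2 * (r * l)) =
      eta + - (2 * l) by rewrite -/eta r2; field; rewrite !gt_eqF.
  by rewrite expRD expRN expRM_natl lnK ?posrE.
have PB1 := large_trig_union mtau lt.
have nl0 : 0 < n%:R * l by rewrite mulr_gt0.
have PB2 := markov_sum_sqr n nl0 i2.
set B1 := \big[setU/set0]_(k < n) _ in PB1.
set B2 := [set w | _] in PB2.
have mB1 : measurable B1.
  by apply: bigsetU_measurable => k _; exact: measurable_large_trig.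
have mB2 : measurable B2.
  rewrite -[X in measurable X]setTI; apply: measurable_fun_le => //.
  by apply: measurable_sum => j; exact: measurable_funX.
have tp : 0 < eps * n%:R `^ (- rho) by rewrite mulr_gt0 ?powR_gt0.
have U0 : 0 <= 6 * (r * l) by rewrite !mulr_ge0 ?(ltW r0) ?(ltW l0).
have Uct : 6 * (r * l) <=
    6 / eps * n%:R `^ (rho + 1 / 2) * l * (eps * n%:R `^ (- rho)).
  by rewrite scaled_threshold.
have mB : measurable (B1 `|` B2) by exact: measurableU.
apply: le_trans (kappa_circulant_prob n0 tp U0 Uct mB _); last first.
  move=> w /not_orP[nB1 /negP]; rewrite -ltNge => /ltW SL k.
  have := dft_truncate_le r0 SL (not_large_trig_union nB1 k).
  have -> : 6 * (r * l) / 2 = 2 * (r * l) + n%:R * l / r.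
    by rewrite -r2; field; rewrite gt_eqF.
  by [].
have fB : fine (P (B1 `|` B2)) <= (sig + 4 * expR eta) * q^-1.
  rewrite -lee_fin fineK ?fin_num_measure//.
  apply: le_trans (measureU2 _ mB1 mB2) _; apply: le_trans (leeD PB1 PB2) _.
  rewrite -EFinD lee_fin -/sig.
  have -> : n%:R * (4 * (expR eta * n%:R ^- 2)) + (n%:R * l)^-1 * (n%:R * sig) =
     4 * expR eta * n%:R^-1 + sig * l^-1 by field; rewrite !gt_eqF.
  rewrite [leRHS]mulrDl addrC; apply: lerD.
    by rewrite ler_wpM2l// lef_pV2 ?posrE// -q2 expr2 ler_peMl// ltW.
  rewrite ler_pM2l ?mulr_gt0// lef_pV2 ?posrE// (le_trans qr)//.
  by rewrite -r2 expr2 ler_peMl// ltW.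
have hs := h1 n n1 n0; rewrite -/r in hs.
have rq : r^-1 <= q^-1 by rewrite lef_pV2 ?posrE.
rewrite lee_fin lerB// (le_trans (lerD fB hs))//.
have : 0 <= (eps ^+ 2 + eps) * n%:R `^ (- (2 * rho)).
  by rewrite mulr_ge0 ?powR_ge0// addr_ge0 ?sqr_ge0// ltW.
move: ((eps ^+ 2 + eps) * _) => X X0.
have : D * r^-1 <= D * q^-1 by rewrite ler_pM2l.
have : 0 <= (sig + 4 * expR eta) * X by rewrite mulr_ge0// addr_ge0// mulr_ge0// ltW.
rewrite -/l -/q; lra.
Qed.

End second_moment.

(** * The condition number under both moment assumptions *)

Theorem mainTheorem6 (R : realType) (d : measure_display) (T : measurableType d)
  (P : probability T R) (xi : nat -> {RV P >-> R}) :
  iid_seq xi -> condH (xi 0%N) ->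
  (* Part (1) *)
  ((P.-integrable setT (EFin \o xi 0%N) /\ ('E_P[xi 0%N] = 0)%E /\
    P.-integrable setT (EFin \o (fun w => xi 0%N w ^+ 2)) /\ (0 < variance P (xi 0%N))%E /\
    (exists t0 : R, 0 < t0 /\ forall t : R, -t0 < t < t0 ->
        P.-integrable setT (EFin \o (fun w => expR (t * xi 0%N w))))) ->
   exists (C0 C1 : R), 0 < C0 /\ 0 < C1 /\
   exists delta : nat -> R, delta @ \oo --> 0 /\
   forall (eps rho : R), 0 < eps -> 0 < rho < 1 / 4 ->
   exists N : nat, forall n : nat, (N <= n)%N ->
     (P [set w | (kappa (circulant n (fun k => xi k w))
                  <= (C0 / eps * n%:R `^ (rho + 1 / 2) * Num.sqrt (ln n%:R))%:E)%E]
      >= (1 - C1 * ((eps ^+ 2 + eps) * n%:R `^ (- (2 * rho))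
                    + n%:R `^ (- (1 / 2) + delta n)))%:E)%E) /\
  (* Part (2) *)
  ((P.-integrable setT (EFin \o xi 0%N) /\ ('E_P[xi 0%N] = 0)%E /\
    P.-integrable setT (EFin \o (fun w => xi 0%N w ^+ 2))) ->
   exists (C0 C2 : R), 0 < C0 /\ 0 < C2 /\
   forall (eps rho : R), 0 < eps -> 0 < rho < 1 / 4 ->
   exists N : nat, forall n : nat, (N <= n)%N ->
     (P [set w | (kappa (circulant n (fun k => xi k w))
                  <= (C0 / eps * n%:R `^ (rho + 1 / 2) * ln n%:R)%:E)%E]
      >= (1 - C2 * ((eps ^+ 2 + eps) * n%:R `^ (- (2 * rho))
                    + (Num.sqrt (ln n%:R))^-1))%:E)%E).
Proof.
move=> iid hH; split.
  move=> [ixi [Exi [_ [_ [t0 [t00 mgf]]]]]].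
  have [C0 [C1 [C00 C10 h]]] := kappa_upper_exp iid hH ixi Exi t00 mgf.
  exists C0, C1; do 2 split=> //.
  exists (fun=> 0); split; first exact: cvg_cst.
  move=> eps rho e0 r01; have [N hN] := h eps rho e0 r01.
  exists N => n nN; have := hN n nN.
  by rewrite addr0 powR_neg_half.
move=> [ixi [Exi i2]].
have [C0 [C2 [C00 C20 h]]] := kappa_upper_sqr iid hH ixi Exi i2.
by exists C0, C2; do 2 split=> //.
Qed.
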